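(* There is a sequence $\epsilon_k\to 0$ such that the following holds. Let $m=\lceil rn\rceil$ for some $r<(1-\epsilon_k)2^k\ln 2$, and let $f(n)$ be any function with $\lim_{n\to\infty}f(n)=\infty$. Let $\mathcal{D}$ be any property such that $F_k(n,m)$ has $\mathcal{D}$ with probability $1-o(1)$, and let $\mathcal{E}$ be any property of pairs $(F,\sigma)\in\Lambda_{n,m}$. If for all sufficiently large $n$ $$\Pr_{\mathcal{P}_{n,m}}\big[(F,\sigma)\text{ has }\mathcal{E}\ \big|\ F\text{ has }\mathcal{D}\big]\ge 1-\exp\!\big(-k2^{3-k}n-f(n)\big),$$ then $\Pr_{\mathcal{U}_{n,m}}[(F,\sigma)\text{ has }\mathcal{E}]=1-o(1)$.
   Context: $F_k(n,m)$ is a random $k$-CNF formula: a set of $m$ distinct clauses chosen uniformly among all $2^k\binom nk$ $k$-clauses over the variables $x_1,\dots,x_n$ (each clause on $k$ distinct variables). $\Lambda_{n,m}$ is the set of pairs $(F,\sigma)$ with $F$ a $k$-CNF formula over $x_1,\dots,x_n$ with $m$ clauses and $\sigma\in\{0,1\}^n$ a satisfying assignment of $F$. $\mathcal{U}_{n,m}$: generate $F=F_k(n,m)$, then a uniformly random satisfying assignment $\sigma$ of $F$ (fail if none), output $(F,\sigma)$. $\mathcal{P}_{n,m}$ (planted model): generate $\sigma\in\{0,1\}^n$ uniformly, then a $k$-CNF formula $F$ with $m$ clauses chosen uniformly among those satisfied by $\sigma$, output $(F,\sigma)$. *)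

(* Defs.v *)
From HB Require Import structures.
From mathcomp Require Import all_boot all_order all_algebra.
From mathcomp Require Import all_classical all_reals all_analysis.

Set Implicit Arguments.
Unset Strict Implicit.
Unset Printing Implicit Defensive.

Import Order.TTheory GRing.Theory Num.Theory.
Local Open Scope ring_scope.

Section FiniteProbability.
Variables (R : realType) (T : finType).

(* [unif set0] is identically 0: a sampling step with nothing to sample from
   contributes no mass. *)
Definition unif (A : {set T}) (x : T) : R := (x \in A)%:R / #|A|%:R.

Definition Pr (mu : T -> R) (A : {set T}) : R := \sum_(x in A) mu x.

(* Equal to 0 when [Pr mu B = 0]. *)
Definition cPr (mu : T -> R) (A B : {set T}) : R :=
  Pr mu (A :&: B) / Pr mu B.

End FiniteProbability.

Section KCNF.
Variables (k n : nat).

(* [(i, true)] is the literal x_i and [(i, false)] its negation. *)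
Definition literal := ('I_n * bool)%type.
Definition clause := {set literal}.
Definition formula := {set clause}.
Definition assignment := {ffun 'I_n -> bool}.

(* The second conjunct says that the k literals are on k distinct variables. *)
Definition kclauses : {set clause} :=
  [set C : clause | (#|C| == k) && (#|[set l.1 | l in C]| == k)].

Definition kcnf (m : nat) : {set formula} :=
  [set F : formula | (F \subset kclauses) && (#|F| == m)].

Definition sat_clause (s : assignment) (C : clause) : bool :=
  [exists l in C, s l.1 == l.2].

Definition satisfies (s : assignment) (F : formula) : bool :=
  [forall C in F, sat_clause s C].

Definition solutions (F : formula) : {set assignment} :=
  [set s | satisfies s F].

Definition Lambda (m : nat) : {set formula * assignment} :=
  [set p | (p.1 \in kcnf m) && satisfies p.2 p.1].

Variable R : realType.

Definition random_kcnf (m : nat) : formula -> R := unif R (kcnf m).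

(* The mass missing from this sub-distribution is the probability that the
   experiment fails, i.e. that the random formula is unsatisfiable. *)
Definition uniform_model (m : nat) (p : formula * assignment) : R :=
  random_kcnf m p.1 * unif R (solutions p.1) p.2.

Definition planted_model (m : nat) (p : formula * assignment) : R :=
  unif R [set: assignment] p.2
  * unif R [set F in kcnf m | satisfies p.2 F] p.1.

End KCNF.

(* ceil (r * n), as a natural number; meant for r >= 0. *)
Definition nclauses (R : realType) (r : R) (n : nat) : nat :=
  `|Num.ceil (r * n%:R)|%N.

(* Main.v *)
Require Import Defs.
From HB Require Import structures.
From mathcomp Require Import all_boot all_order all_algebra.
From mathcomp Require Import all_classical all_reals all_analysis.
From mathcomp Require Import ring lra.

Set Implicit Arguments.
Unset Strict Implicit.
Unset Printing Implicit Defensive.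

Import Order.TTheory GRing.Theory Num.Theory.
Import numFieldNormedType.Exports.
Local Open Scope ring_scope.

(** Let L be the number of satisfying assignments of a random sequence of
    clauses, each solution weighted by a product of balanced clause weights
    w = (1 - b H) [satisfied], H being the number of true minus the number of
    false literals, and divided by its expectation.  Balancing (E[w H] = 0)
    cancels the linear term of the overlap rate function, so for r below
    (1 - eps_k) 2^k ln 2 pairs at overlap x contribute at most exp(- c n x^2) to
    E[L^2].

    Without a sharp-threshold theorem, L > 0 is obtained with high probability
    as follows.  L is a martingale in the number of clauses.  As long as
    L >= exp(- g), all but a negligible part of L^2 sits at overlaps
    x^2 = O(g / n), so a step has relative variance O(g / n), and a clause can
    divide L by 8 only if its k variables all lie among the O(sqrt (g n)) biased
    ones, which has probability O((g / n)^2).  Hence E[1 / L] grows by a factor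
    1 + O(g / n) per step, and letting g grow at the same rate from 3 ln n gives
    L >= exp(- O(ln n)) throughout the O(n) steps.

    Typical weighted solutions have H >= - n, so the number of solutions is at
    least its mean times exp(- 3 k 2^-k n - O(ln n)); this loss is smaller than
    the exponential gain assumed under the planted model, which is the uniform
    distribution on pairs (F, s). *)

(** * Independent clauses and lower tails of martingales *)

Section IidSequences.
Variables (R : realType) (T : finType) (A : {set T}).

Definition avg (phi : T -> R) : R := (\sum_(C in A) phi C) / #|A|%:R.

(** Expectation over sequences of j independent uniform elements of [A]. The newest element is the
    head and is averaged innermost, so conditioning on the past holds by definition. *)
Fixpoint Ex (j : nat) (phi : seq T -> R) : R :=
  if j is j'.+1 then Ex j' (fun s => avg (fun C => phi (C :: s)))
  else phi [::].

Lemma ler_avg (phi psi : T -> R) :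
  (forall C, C \in A -> phi C <= psi C) -> avg phi <= avg psi.
Proof.
move=> h; rewrite /avg ler_wpM2r ?invr_ge0 ?ler0n //.
by apply: ler_sum => C; apply: h.
Qed.

Lemma eq_avg (phi psi : T -> R) :
  (forall C, C \in A -> phi C = psi C) -> avg phi = avg psi.
Proof. by move=> h; congr (_ / _); apply: eq_bigr. Qed.

Lemma avgD (phi psi : T -> R) :
  avg (fun C => phi C + psi C) = avg phi + avg psi.
Proof. by rewrite /avg big_split mulrDl. Qed.

Lemma avgZ (a : R) (phi : T -> R) :
  avg (fun C => a * phi C) = a * avg phi.
Proof. by rewrite /avg -mulr_sumr mulrA. Qed.

Lemma avg_sum (I : finType) (P : pred I) (phi : I -> T -> R) :
  avg (fun C => \sum_(i | P i) phi i C) = \sum_(i | P i) avg (phi i).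
Proof. by rewrite /avg exchange_big mulr_suml. Qed.

Lemma avg_ge0 (phi : T -> R) :
  (forall C, C \in A -> 0 <= phi C) -> 0 <= avg phi.
Proof. by move=> h; rewrite divr_ge0 ?ler0n // sumr_ge0. Qed.

Lemma ler_Ex (j : nat) (phi psi : seq T -> R) :
  (forall s, size s = j -> all (mem A) s -> phi s <= psi s) ->
  Ex j phi <= Ex j psi.
Proof.
elim: j phi psi => [|j IH] phi psi h /=; first exact: h.
apply: IH => s sj sA; apply: ler_avg => C CA.
by apply: h; rewrite /= ?sj // CA.
Qed.

Lemma eq_Ex (j : nat) (phi psi : seq T -> R) :
  (forall s, size s = j -> all (mem A) s -> phi s = psi s) ->
  Ex j phi = Ex j psi.
Proof.
move=> h; apply/eqP; rewrite eq_le.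
by apply/andP; split; apply: ler_Ex => s sj sA; rewrite h.
Qed.

Lemma ExD (j : nat) (phi psi : seq T -> R) :
  Ex j (fun s => phi s + psi s) = Ex j phi + Ex j psi.
Proof.
elim: j phi psi => [|j IH] phi psi //=.
by rewrite -IH; apply: eq_Ex => s _ _; rewrite avgD.
Qed.

Lemma ExZ (j : nat) (a : R) (phi : seq T -> R) :
  Ex j (fun s => a * phi s) = a * Ex j phi.
Proof.
elim: j phi => [|j IH] phi //=.
by rewrite -IH; apply: eq_Ex => s _ _; rewrite avgZ.
Qed.

Lemma Ex_sum (I : finType) (P : pred I) (j : nat) (phi : I -> seq T -> R) :
  Ex j (fun s => \sum_(i | P i) phi i s) = \sum_(i | P i) Ex j (phi i).
Proof.
elim: j phi => [|j IH] phi //=.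
by rewrite -IH; apply: eq_Ex => s _ _; rewrite avg_sum.
Qed.

Lemma Ex_ge0 (j : nat) (phi : seq T -> R) :
  (forall s, size s = j -> all (mem A) s -> 0 <= phi s) -> 0 <= Ex j phi.
Proof.
move=> h; have <- : Ex j (fun s => 0 * phi s) = 0 by rewrite ExZ mul0r.
by apply: ler_Ex => s sj sA; rewrite mul0r h.
Qed.

Lemma Ex_prod (j : nat) (h : T -> R) :
  Ex j (fun s => \prod_(C <- s) h C) = avg h ^+ j.
Proof.
elim: j => [|j IH] /=; first by rewrite big_nil expr0.
rewrite exprS -IH -ExZ; apply: eq_Ex => s _ _.
rewrite mulrC -avgZ; apply: eq_avg => C _.
by rewrite big_cons mulrC.
Qed.

Hypothesis A_gt0 : (0 < #|A|)%N.

Lemma avg_cst (a : R) : avg (fun=> a) = a.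
Proof.
rewrite /avg sumr_const -[a *+ _]mulr_natr mulfK //.
by rewrite pnatr_eq0 -lt0n.
Qed.

Lemma Ex_cst (j : nat) (a : R) : Ex j (fun=> a) = a.
Proof.
elim: j => [|j IH] //=; rewrite -[RHS]IH.
by apply: eq_Ex => s _ _; rewrite avg_cst.
Qed.

Lemma Ex_markov (j : nat) (a : R) (phi : seq T -> R) : 0 < a ->
  (forall s, size s = j -> all (mem A) s -> 0 <= phi s) ->
  Ex j (fun s => (a < phi s)%R%:R) <= Ex j phi / a.
Proof.
move=> a0 h; rewrite mulrC -ExZ; apply: ler_Ex => s sj sA.
have p0 := h s sj sA.
have [hp|hp] := ltP a (phi s); last by rewrite mulr_ge0 // invr_ge0 ltW.
by rewrite ler_pdivlMl // mulr1 ltW.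
Qed.

(** * Lower tail of a nonnegative martingale through its inverse moment *)

Section Martingale.
Variables (L : seq T -> R) (O : pred (seq T)) (g V : nat -> R).
Variables (m : nat) (p1 p2 : R).
Hypothesis L_nil : L [::] = 1.
Hypothesis L_ge0 : forall s, all (mem A) s -> 0 <= L s.
Hypothesis L_martingale :
  forall s, all (mem A) s -> avg (fun C => L (C :: s)) = L s.
Hypothesis O_tail :
  forall j, (j < m)%N -> Ex j (fun s => (~~ O s)%:R) <= p1.
Hypothesis step_var : forall s, (size s < m)%N -> all (mem A) s -> O s ->
  expR (- g (size s)) <= L s ->
  avg (fun C => (L (C :: s) - L s) ^+ 2) <= V (size s) * L s ^+ 2.
Hypothesis step_kill : forall s, (size s < m)%N -> all (mem A) s -> O s ->
  expR (- g (size s)) <= L s ->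
  avg (fun C => (8 * L (C :: s) < L s)%R%:R) <= p2.
Hypothesis g0_ge0 : 0 <= g 0%N.
Hypothesis g_step : forall j, 8 * V j <= g j.+1 - g j.
Hypothesis p2_ge0 : 0 <= p2.

(** Histories that have not been stopped: [O] held before every step, no step divided [L] by more
    than 8, and [L] never fell below the floor exp(- g). *)
Fixpoint good (s : seq T) : bool :=
  if s is C :: s' then
    [&& good s', O s', L s' <= 8 * L s & expR (- g (size s)) <= L s]
  else true.

Lemma good_lb s : good s -> expR (- g (size s)) <= L s.
Proof.
case: s => [_|C s /and4P[]//].
by rewrite L_nil -expR0 ler_expR oppr_le0.
Qed.

(** With X the relative increment of [L], 8 (1 + X) >= 1 gives 1 / (1 + X) <= 1 - X + 8 X^2. The
    linear term averages to zero by the martingale property, and the quadratic one is what [g_step]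
    pays for. *)
Lemma step_inv s : (size s < m)%N -> all (mem A) s -> good s -> O s ->
  avg (fun C => (L s <= 8 * L (C :: s))%R%:R / L (C :: s)) <=
  expR (g (size s).+1 - g (size s)) / L s.
Proof.
move=> sm sA gs Os; have lb := good_lb gs.
have L0 : 0 < L s := lt_le_trans (expR_gt0 _) lb.
have LV : (L s)^-1 > 0 by rewrite invr_gt0.
apply: (@le_trans _ _ (avg (fun C => (L s)^-1 +
   ((- (L s)^-1 ^+ 2) * L (C :: s) + ((L s)^-1 +
    8 * (L s)^-1 ^+ 3 * (L (C :: s) - L s) ^+ 2))))).
  apply: ler_avg => C CA.
  have := L_ge0 (s := C :: s); rewrite /= CA sA => /(_ isT).
  set a := L s in L0 LV *; set b := L (C :: s) => b0.
  have -> : a^-1 + (- a^-1 ^+ 2 * b + (a^-1 + 8 * a^-1 ^+ 3 * (b - a) ^+ 2)) =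
            a^-1 * (1 - (b - a) / a + 8 * ((b - a) / a) ^+ 2).
    by field; rewrite gt_eqF.
  set X := (b - a) / a.
  have bE : b = a * (1 + X) by rewrite /X; field; rewrite gt_eqF.
  (* On a step that loses more than a factor 8 the left side is 0, and the quadratic bound is
     nonnegative for every X. *)
  have [hb|hb] /= := leP a (8 * b); last first.
    by rewrite ?mulr0n mul0r mulr_ge0 ?(ltW LV)//; nra.
  have X1 : 1 <= 8 * (1 + X).
    by rewrite -(ler_pM2l L0) mulr1 mulrCA -bE.
  have X0 : 0 < 1 + X by lra.
  rewrite ?mulr1n mul1r bE invfM ler_pM2l // -(ler_pM2r X0) mulVf ?gt_eqF //; nra.
rewrite !avgD !avgZ L_martingale // !avg_cst.
have -> : (L s)^-1 + (- (L s)^-1 ^+ 2 * L s + ((L s)^-1 + 8 * (L s)^-1 ^+ 3 *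
    avg (fun C => (L (C :: s) - L s) ^+ 2))) = (L s)^-1 * (1 + 8 * 
    (avg (fun C => (L (C :: s) - L s) ^+ 2) / L s ^+ 2)).
  by field; rewrite gt_eqF.
rewrite [leRHS]mulrC ler_pM2l //.
apply: le_trans (expR_ge1Dx _); rewrite lerD2l.
apply: le_trans (g_step _); rewrite ler_pM2l //.
by rewrite ler_pdivrMr ?exprn_gt0 // step_var.
Qed.

(** The factors of [step_inv] telescope from 1 / L = 1 at the empty sequence. Restricting to [good]
    histories keeps L away from 0. *)
Lemma good_inv_moment j : (j <= m)%N ->
  Ex j (fun s => (good s)%:R / L s) <= expR (g j - g 0%N).
Proof.
elim: j => [|j IH] jm /=.
  by rewrite L_nil subrr expR0 divr1.
have -> : g j.+1 - g 0%N = (g j.+1 - g j) + (g j - g 0%N) by ring.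
rewrite expRD; apply: le_trans (ler_wpM2l (expR_ge0 _) (IH (ltnW jm))).
rewrite -ExZ; apply: ler_Ex => s sj sA.
case gs: (good s) => /=; last first.
  rewrite ?mulr0n mul0r mulr0 (@eq_avg _ (fun=> 0)) ?avg_cst // => C _.
  by rewrite ?mulr0n mul0r.
case Os: (O s) => /=; last first.
  rewrite (@eq_avg _ (fun=> 0)) ?avg_cst => [|C _]; last by rewrite ?mulr0n mul0r.
  rewrite mulr_ge0 ?expR_ge0 // ?mulr1n mul1r invr_ge0; exact: L_ge0.
rewrite ?mulr1n mul1r -sj; apply: le_trans (step_inv _ sA gs Os); last by rewrite sj.
apply: ler_avg => C CA; rewrite ler_wpM2r //.
  by rewrite invr_ge0; apply: L_ge0; rewrite /= CA.
by rewrite ler_nat; case: (L s <= _); case: (_ <= L _).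
Qed.

(** A history stops being good in one of three ways per step: [O] fails ([p1]), the step loses a
    factor 8 ([p2]), or L drops below the floor, which Markov's inequality for 1 / L bounds by exp(-
    g 0). *)
Lemma good_fail j : (j <= m)%N ->
  Ex j (fun s => (~~ good s)%:R) <= j%:R * (p1 + p2 + expR (- g 0%N)).
Proof.
elim: j => [|j IH] jm; first by rewrite mul0r.
rewrite -natr1 mulrDl mul1r; apply: le_trans (lerD (IH (ltnW jm)) (lexx _)).
(* Markov's inequality costs exp(- g (j+1)) times the next mean of 1 / L, and [step_inv] turns this
   into exp(- g j) / L. *)
pose G := expR (- g j) .
apply: (@le_trans _ _ (Ex j (fun s => (~~ good s)%:R + ((~~ O s)%:R +
   (p2 + G * ((good s)%:R / L s)))))).
  rewrite [Ex j.+1 _]/=; apply: ler_Ex => s sj sA /=.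
  have L0 := L_ge0 sA.
  have H0 : 0 <= (good s)%:R / L s by rewrite divr_ge0 // ler0n.
  have G0 : 0 <= G * ((good s)%:R / L s) by rewrite mulr_ge0 // expR_ge0.
  have le1 : avg (fun C => (~~ [&& good s, O s, L s <= 8 * L (C :: s) &
       expR (- g (size s).+1) <= L (C :: s)])%R%:R) <= 1.
    rewrite -[leRHS]avg_cst; apply: ler_avg => C _; by rewrite lern1 leq_b1.
  have [/andP[gs Os]|] := boolP (good s && O s); last first.
    have O0 : 0 <= (~~ O s)%:R :> R by [].
    have g0 : 0 <= (~~ good s)%:R :> R by [].
    rewrite negb_and; case/orP=> h; apply: le_trans le1 _.
      by rewrite h [true%:R]mulr1n lerDl !addr_ge0.
    by rewrite h [true%:R]mulr1n addrCA lerDl !addr_ge0.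
  rewrite gs Os /=.
  rewrite !mulr0n !add0r mulr1n; apply: (@le_trans _ _ (avg (fun C =>
     (8 * L (C :: s) < L s)%R%:R + expR (- g j.+1) *
     ((L s <= 8 * L (C :: s))%R%:R / L (C :: s))))).
    apply: ler_avg => C CA; have := L_ge0 (s := C :: s).
    rewrite /= CA sA => /(_ isT) b0.
    have sL0 : 0 < L s := lt_le_trans (expR_gt0 _) (good_lb gs).
    have [h1|h1] /= := leP (L s) (8 * L (C :: s)); last first.
      by rewrite !(mulr0n,mul0r,mulr0,addr0).
    rewrite ?mulr0n add0r ?mulr1n mul1r sj.
    have [h2|h2] /= := leP (expR (- g j.+1)) (L (C :: s)).
      by rewrite mulr_ge0 ?expR_ge0 ?invr_ge0.
    have b1 : 0 < L (C :: s).
      by rewrite -(pmulr_rgt0 _ (ltr0n R 8)) (lt_le_trans sL0).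
    by rewrite ler_pdivlMr // mul1r ltW.
  rewrite avgD avgZ; apply: lerD.
    by apply: step_kill; rewrite ?sj // -sj good_lb.
  apply: (@le_trans _ _ (expR (- g j.+1) * (expR (g j.+1 - g j) / L s))).
    rewrite ler_wpM2l ?expR_ge0 // -sj; apply: step_inv; by rewrite ?sj.
  by rewrite mulrA -expRD mul1r addrA addNr add0r.
rewrite !ExD Ex_cst ExZ lerD2l -addrA lerD ?O_tail // lerD2l.
apply: le_trans (ler_wpM2l (expR_ge0 _) (good_inv_moment (ltnW jm))) _.
by rewrite -expRD addrA addNr add0r.
Qed.

Lemma martingale_lower_tail :
  Ex m (fun s => (L s < expR (- g m))%R%:R) <=
  m%:R * (p1 + p2 + expR (- g 0%N)).
Proof.
apply: le_trans (good_fail (leqnn m)); apply: ler_Ex => s sm _.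
rewrite ler_nat; case gs: (good s) => /=; last exact: leq_b1.
by rewrite ltNge -sm good_lb.
Qed.

End Martingale.

End IidSequences.

(** * Averages over clauses *)

(** Falling factorials are compared factor by factor: (d - i) n <= (n - i) d. *)
Lemma bin_ratio (d n k : nat) : (d <= n)%N ->
  ('C(d, k) * n ^ k <= 'C(n, k) * d ^ k)%N.
Proof.
move=> dn; rewrite -(leq_pmul2r (fact_gt0 k)).
rewrite (mulnAC 'C(d, k)) (mulnAC 'C(n, k)) !bin_ffact.
elim: k => [|k IH]; first by rewrite !ffactn0.
rewrite !ffactnSr !expnSr mulnACA [leqRHS]mulnACA leq_mul //.
rewrite !mulnBl [(n * d)%N]mulnC leq_sub2l // leq_mul2l dn orbT //.
Qed.

Lemma bin_ratioR (R : realType) (d n k : nat) : (d <= n)%N -> (k <= n)%N ->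
  (0 < n)%N -> 'C(d, k)%:R / 'C(n, k)%:R <= (d%:R / n%:R) ^+ k :> R.
Proof.
move=> dn kn n0.
rewrite expr_div_n ler_pdivrMr ?ltr0n ?bin_gt0 // mulrAC.
rewrite ler_pdivlMr ?exprn_gt0 ?ltr0n // -!natrX -!natrM ler_nat mulnC.
by rewrite mulnC [leqRHS]mulnC bin_ratio.
Qed.

Section ClauseAverages.
Variables (R : realType) (k n : nat).
Implicit Types (S : {set 'I_n}) (rho s t : assignment n).

(** Serves both for the random signs of a clause and for uniformly random truth assignments. *)
Definition EA (phi : assignment n -> R) : R := (\sum_rho phi rho) / 2 ^+ n.

Lemma EA_sum (I : finType) (P : pred I) (phi : I -> assignment n -> R) :
  EA (fun rho => \sum_(i | P i) phi i rho) = \sum_(i | P i) EA (phi i).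
Proof. by rewrite /EA exchange_big mulr_suml. Qed.

Lemma EAD (phi psi : assignment n -> R) :
  EA (fun rho => phi rho + psi rho) = EA phi + EA psi.
Proof. by rewrite /EA big_split mulrDl. Qed.

Lemma EAZ (a : R) (phi : assignment n -> R) :
  EA (fun rho => a * phi rho) = a * EA phi.
Proof. by rewrite /EA -mulr_sumr mulrA. Qed.

Lemma eq_EA (phi psi : assignment n -> R) : phi =1 psi -> EA phi = EA psi.
Proof. by move=> h; rewrite /EA (eq_bigr _ (fun i _ => h i)). Qed.

Lemma card_assignment : #|{: assignment n}| = (2 ^ n)%N.
Proof. by rewrite card_ffun card_bool card_ord. Qed.

Lemma EA_cst (a : R) : EA (fun=> a) = a.
Proof.
rewrite /EA sumr_const card_assignment -[a *+ _]mulr_natr natrX mulfK //.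
Qed.

Lemma EA_prod S (f : 'I_n -> bool -> R) :
  EA (fun rho => \prod_(i in S) f i (rho i)) =
  \prod_(i in S) ((f i true + f i false) / 2).
Proof.
pose f' i b := if i \in S then f i b else 1.
transitivity (\prod_i ((f' i true + f' i false) / 2)); last first.
  rewrite [RHS]big_mkcond; apply: eq_bigr => i _; rewrite /f'.
  by case: ifP => // _; field.
rewrite big_split /= prodr_const card_ord exprVn; congr (_ / _).
transitivity (\sum_(rho : assignment n) \prod_i f' i (rho i)).
  by apply: eq_bigr => rho _; rewrite big_mkcond.
rewrite -(bigA_distr_bigA f'); apply: eq_bigr => i _.
by rewrite big_bool.
Qed.

Definition flip (i : 'I_n) rho : assignment n :=
  [ffun j => if j == i then ~~ rho j else rho j].

Lemma flipK i : involutive (flip i).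
Proof. by move=> rho; apply/ffunP => j; rewrite !ffunE; case: eqP; rewrite ?negbK. Qed.

Lemma EA_odd (i : 'I_n) (phi : assignment n -> R) :
  (forall rho, phi (flip i rho) = - phi rho) -> EA phi = 0.
Proof.
move=> h; have e : EA phi = - EA phi.
  rewrite {1}/EA (reindex_inj (inv_inj (flipK i))) /=.
  by rewrite (eq_bigr _ (fun r _ => h r)) sumrN mulNr.
by lra.
Qed.

(** The signs are given on all variables although only those in [S] matter, so that averages over
    signs are plain instances of [EA]. *)
Definition clause_of S rho : clause n := [set (i, rho i) | i in S].

Lemma clause_of_inj rho : injective (fun i : 'I_n => (i, rho i)).
Proof. by move=> i j []. Qed.

Lemma vars_clause_of S rho : [set l.1 | l in clause_of S rho] = S.
Proof. by rewrite -imset_comp (eq_imset (g := id)) ?imset_id. Qed.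

Lemma clause_of_kclauses S rho : #|S| = k -> clause_of S rho \in kclauses k n.
Proof.
move=> Sk; rewrite inE vars_clause_of Sk eqxx andbT.
by rewrite card_imset ?Sk //; apply: clause_of_inj.
Qed.

(** Having k literals on k variables, [C] contains exactly one literal per variable, hence is
    determined by its variables and its positive literals. *)
Lemma kclauses_clause_of (C : clause n) : C \in kclauses k n ->
  C = clause_of [set l.1 | l in C] [ffun i => (i, true) \in C].
Proof.
rewrite inE => /andP[/eqP Ck /eqP vk].
have /imset_injP inj : #|[set l.1 | l in C]| == #|C| by rewrite Ck vk.
have key i b : (i, b) \in C -> ((i, true) \in C) = b.
  case: b => // h; apply/negP => h'.
  by have := inj _ _ h h' erefl.
apply/setP => -[i b]; apply/idP/imsetP => [h|[j /imsetP[[j' b'] h /= ->]]].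
  exists i; first by apply/imsetP; exists (i, b).
  by rewrite ffunE (key _ _ h).
by rewrite ffunE (key _ _ h) => -[-> ->].
Qed.

Lemma eq_clause_of S S' rho rho' : (clause_of S rho == clause_of S' rho') =
  (S == S') && [forall i in S, rho i == rho' i].
Proof.
apply/eqP/andP => [e|[/eqP <- /forall_inP e]]; last first.
  by apply: eq_in_imset => i iS; rewrite (eqP (e i iS)).
have eS : S = S' by rewrite -(vars_clause_of S rho) e vars_clause_of.
split; first exact/eqP.
apply/forall_inP => i iS.
have : (i, rho i) \in clause_of S' rho' by rewrite -e; apply/imsetP; exists i.
by case/imsetP => j _ [-> ->].
Qed.

Lemma EA_eq_clause_of S c : #|S| = k ->
  EA (fun rho => (clause_of S c == clause_of S rho)%:R) = 2 ^- k.
Proof.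
move=> Sk; rewrite -exprVn -Sk -prodr_const.
under eq_EA => rho.
  rewrite eq_clause_of eqxx /=.
  have -> : ([forall i in S, c i == rho i])%:R =
     \prod_(i in S) (c i == rho i)%:R :> R.
    have [/forall_inP h|/forall_inPn[i iS ci]] := boolP [forall i in S, c i == rho i].
      by rewrite big1 // => i iS; rewrite h.
    by rewrite (bigD1 i) //= (negbTE ci) mul0r.
  over.
rewrite (EA_prod S (fun i b => (c i == b)%:R)); apply: eq_bigr => i _.
by case: (c i) => /=; rewrite ?mulr0n ?mulr1n ?addr0 ?add0r mul1r.
Qed.

(** Each k-clause comes from a single variable set and from a fraction 2^-k of the sign patterns: a
    uniform clause is a uniform k-set of variables with independent uniform signs. *)
Lemma sum_clause_of (phi : clause n -> R) :
  \sum_(S : {set 'I_n} | #|S| == k) EA (fun rho => phi (clause_of S rho)) =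
  2 ^- k * \sum_(C in kclauses k n) phi C.
Proof.
transitivity (\sum_(S : {set 'I_n} | #|S| == k) \sum_(C in kclauses k n)
   phi C * EA (fun rho => (C == clause_of S rho)%:R)).
  apply: eq_bigr => S /eqP Sk; under eq_bigr => C _ do rewrite -EAZ.
  rewrite -EA_sum; apply: eq_EA => rho.
  rewrite (bigD1 (clause_of S rho)) ?clause_of_kclauses //= eqxx mulr1.
  rewrite big1 ?addr0 // => C /andP[_ /negbTE ->]; exact: mulr0.
rewrite exchange_big mulr_sumr; apply: eq_bigr => C CK /=.
rewrite -mulr_sumr mulrC; congr (_ * _).
have CE := kclauses_clause_of CK; set S := [set l.1 | l in C] in CE.
have Sk : #|S| = k by move: CK; rewrite inE => /andP[_ /eqP].
rewrite (bigD1 S) ?Sk //= big1 => [|S' /andP[_ SS']].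
  by rewrite addr0 CE EA_eq_clause_of.
rewrite -[RHS](EA_cst 0); apply: eq_EA => rho.
by rewrite CE eq_clause_of eq_sym (negbTE SS').
Qed.

Lemma card_kclauses : #|kclauses k n| = (2 ^ k * 'C(n, k))%N.
Proof.
apply/eqP; rewrite -(eqr_nat R) natrM natrX.
have := sum_clause_of (fun=> 1); rewrite sumr_const EA_cst sumr_const => e.
have -> : 'C(n, k)%:R = 2 ^- k * #|kclauses k n|%:R :> R.
  rewrite -e; congr (_%:R); rewrite -[X in 'C(X, _)]card_ord -card_draws.
  by apply: eq_card => S; rewrite !inE.
by rewrite mulrA mulfV ?mul1r // expf_neq0 // pnatr_eq0.
Qed.

Lemma avg_kclauses (phi : clause n -> R) :
  avg (kclauses k n) phi =
  (\sum_(S : {set 'I_n} | #|S| == k) EA (fun rho => phi (clause_of S rho)))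
  / 'C(n, k)%:R.
Proof.
rewrite /avg sum_clause_of card_kclauses natrM natrX invfM mulrA.
by congr (_ / _); rewrite mulrC.
Qed.

End ClauseAverages.

(** * Balanced clause weights *)

Section ClauseWeights.
Variables (R : realType) (k n : nat).
Implicit Types (S : {set 'I_n}) (C : clause n) (rho s t : assignment n).

Definition sg (b : bool) : R := if b then 1 else -1.

Definition literal_balance s C : R := \sum_(l in C) sg (s l.1 == l.2).

Definition violated s C : R := (~~ sat_clause s C)%:R.

Definition overlap s t : R := \sum_i sg (s i == t i).

Definition agreement s t : {set 'I_n} := [set i | s i == t i].

Lemma balance_clause_of s S rho :
  literal_balance s (clause_of S rho) = \sum_(i in S) sg (s i == rho i).
Proof. by rewrite /literal_balance big_imset //= => i j _ _ []. Qed.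

Lemma sat_clause_of s S rho :
  sat_clause s (clause_of S rho) = [exists i in S, s i == rho i].
Proof.
apply/exists_inP/exists_inP => [[l /imsetP[i iS ->] h]|[i iS h]].
  by exists i.
by exists (i, rho i) => //; apply/imsetP; exists i.
Qed.

Lemma violated_clause_of s S rho :
  violated s (clause_of S rho) = \prod_(i in S) (s i != rho i)%:R.
Proof.
rewrite /violated sat_clause_of; case: exists_inP => [[i iS h]|h] /=.
  by rewrite (bigD1 i) //= h mul0r.
rewrite big1 // => i iS; case: eqP => // e; case: h; exists i => //.
exact/eqP.
Qed.

Lemma sgM (a b c : bool) : sg (a == c) * sg (b == c) = sg (a == b).
Proof. by case: a; case: b; case: c; rewrite /sg /= ?mulrNN ?mulr1 ?mul1r. Qed.

(** If s violates the clause, every literal is opposite to s, so t makes a literal false exactly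
    where it agrees with s. *)
Lemma violated_balance s t S rho :
  violated s (clause_of S rho) * literal_balance t (clause_of S rho) =
  - (violated s (clause_of S rho) * \sum_(i in S) sg (s i == t i)).
Proof.
rewrite balance_clause_of /violated sat_clause_of.
case: exists_inP => [_|h] /=; first by rewrite !mul0r oppr0.
rewrite !mul1r -sumrN; apply: eq_bigr => i iS.
have : s i != rho i by apply/negP => e; case: h; exists i.
by case: (s i); case: (t i); case: (rho i); rewrite /sg /= ?opprK.
Qed.

(** A clause violated by s has its signs fixed, so t violates it too exactly when t agrees with s on
    S. *)
Lemma violated2 s t S rho :
  violated s (clause_of S rho) * violated t (clause_of S rho) =
  (S \subset agreement s t)%:R * violated s (clause_of S rho).
Proof.
rewrite /violated !sat_clause_of.
case: exists_inP => [_|h] /=; first by rewrite mul0r mulr0.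
rewrite mul1r mulr1; congr (_%:R).
have hs i : i \in S -> s i != rho i.
  by move=> iS; apply/negP => e; case: h; exists i.
rewrite negb_exists; congr nat_of_bool.
apply/idP/idP => [/forallP ht|/fintype.subsetP hS].
  apply/fintype.subsetP => i iS; have := ht i; rewrite iS /= inE; have := hs i iS.
  by case: (s i); case: (t i); case: (rho i).
apply/forallP => i; apply/negP => /andP[iS ti]; have := hS i iS; have := hs i iS.
by rewrite inE; move: ti; case: (s i); case: (t i); case: (rho i).
Qed.

Lemma EA_violated s S : #|S| = k ->
  EA (fun rho => violated s (clause_of S rho)) = 2 ^- k.
Proof.
move=> Sk; rewrite -exprVn -Sk -prodr_const.
under eq_EA => rho do rewrite violated_clause_of.
rewrite (EA_prod S (fun i b => (s i != b)%:R)); apply: eq_bigr => i _.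
by case: (s i) => /=; rewrite ?mulr0n ?mulr1n ?addr0 ?add0r mul1r.
Qed.

Lemma EA_balance s S :
  EA (fun rho => literal_balance s (clause_of S rho)) = 0.
Proof.
under eq_EA => rho do rewrite balance_clause_of.
rewrite EA_sum big1 // => i _; apply: (@EA_odd _ _ i) => rho.
rewrite ffunE eqxx; case: (s i); case: (rho i); by rewrite /sg /= ?opprK.
Qed.

(** Cross terms on two different variables are odd under flipping one sign and vanish. *)
Lemma EA_balance2 s t S :
  EA (fun rho => literal_balance s (clause_of S rho) *
                 literal_balance t (clause_of S rho)) =
  \sum_(i in S) sg (s i == t i).
Proof.
under eq_EA => rho do rewrite !balance_clause_of mulr_suml.
rewrite EA_sum; apply: eq_bigr => i iS.
under eq_EA => rho do rewrite mulr_sumr.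
rewrite EA_sum (bigD1 i) //= big1 ?addr0.
  rewrite -[RHS](@EA_cst _ n); apply: eq_EA => rho; exact: sgM.
move=> j /andP[_ ji]; apply: (@EA_odd _ _ i) => rho.
rewrite !ffunE eqxx (negbTE ji) -mulNr; congr (_ * _).
by case: (s i); case: (rho i); rewrite /sg /= ?opprK.
Qed.

(** By symmetry every variable lies in the same number of k-sets, a fraction k / n of them. *)
Lemma sum_draws (y : 'I_n -> R) :
  n%:R * \sum_(S : {set 'I_n} | #|S| == k) \sum_(i in S) y i =
  k%:R * 'C(n, k)%:R * \sum_i y i.
Proof.
have draws_card : #|[pred S : {set 'I_n} | #|S| == k]| = 'C(n, k).
  rewrite -[X in 'C(X, _)]card_ord -card_draws.
  by apply: eq_card => S; rewrite !inE.
have cnt i : (\sum_(S : {set 'I_n} | (#|S| == k) && (i \in S)) 1 : R) =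
   'C(n, k)%:R - 'C(n.-1, k)%:R.
  apply/eqP; rewrite eq_sym subr_eq; apply/eqP.
  transitivity (\sum_(S : {set 'I_n} | #|S| == k) 1 : R).
    by rewrite sumr_const draws_card.
  rewrite (bigID (fun S : {set 'I_n} => i \in S)) /=; congr (_ + _).
  rewrite sumr_const; congr (_%:R).
  have <- : #|[set~ i]| = n.-1 by rewrite cardsC1 card_ord.
  rewrite -cards_draws; apply: eq_card => S; rewrite !inE andbC.
  congr (_ && _); apply/idP/fintype.subsetP => [iS j jS|h].
    by rewrite !inE; apply: contraNneq iS => <-.
  by apply/negP => /h; rewrite !inE eqxx.
pose c : R := 'C(n, k)%:R - 'C(n.-1, k)%:R.
have sumE (z : 'I_n -> R) :
  \sum_(S : {set 'I_n} | #|S| == k) \sum_(i in S) z i = c * \sum_i z i.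
  under eq_bigr => S _ do rewrite big_mkcond /=.
  rewrite exchange_big mulr_sumr; apply: eq_bigr => i _ /=.
  rewrite -big_mkcondr /= /c -(cnt i) mulr_suml.
  by apply: eq_bigr => S _; rewrite mul1r.
(* The case y = 1 evaluates the common count c. *)
have := sumE (fun=> 1).
rewrite [\sum_(i < n) 1]sumr_const card_ord.
under eq_bigr => S /eqP Sk do rewrite sumr_const Sk.
rewrite sumr_const draws_card => e.
by rewrite sumE mulrA [n%:R * c]mulrC -e mulr_natr.
Qed.

Lemma overlapE s t : overlap s t = 2 * #|agreement s t|%:R - n%:R.
Proof.
rewrite /overlap (bigID (fun i => s i == t i)) /=.
rewrite (eq_bigr (fun=> 1)) => [|i ->//].
rewrite [X in _ + X](eq_bigr (fun=> -1)) => [|i /negbTE ->//].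
rewrite !sumr_const.
have -> : #|[pred i | s i == t i]| = #|agreement s t|.
  by apply: eq_card => i; rewrite !inE.
have -> : #|[pred i | s i != t i]| = #|~: agreement s t|.
  by apply: eq_card => i; rewrite !inE.
have := cardsC (agreement s t); rewrite card_ord => e.
rewrite -[in n%:R]e natrD mulNrn; lra.
Qed.

Variable b : R.
(* The balance condition E[w H] = 0. *)
Hypothesis b_balanced : 1 + b * k%:R = 2 ^+ k * b.

Definition weight s C : R :=
  (1 - b * literal_balance s C) * (sat_clause s C)%:R.

(** On a violated clause H = - k, so 1 - b H = 1 + b k = 2^k b. The balance condition thus makes the
    weight affine in H and the violation indicator, with known moments. *)
Lemma weight_clause_of s S rho : #|S| = k ->
  weight s (clause_of S rho) =
  1 - b * literal_balance s (clause_of S rho)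
    - 2 ^+ k * b * violated s (clause_of S rho).
Proof.
move=> Sk; have := violated_balance s s S rho.
have -> : \sum_(i in S) sg (s i == s i) = k%:R.
  by under eq_bigr do rewrite eqxx; rewrite sumr_const Sk.
rewrite -b_balanced /weight /violated.
by case: sat_clause => /= h; rewrite ?mulr0n ?mulr1n in h *; nra.
Qed.

Lemma EA_weight s S : #|S| = k ->
  EA (fun rho => weight s (clause_of S rho)) = 1 - b.
Proof.
move=> Sk.
rewrite (@eq_EA _ _ _ (fun rho => 1 +
   ((- b) * literal_balance s (clause_of S rho) +
    (- (2 ^+ k * b)) * violated s (clause_of S rho)))); last first.
  by move=> rho; rewrite weight_clause_of //; ring.
rewrite !EAD !EAZ EA_cst EA_balance EA_violated //; field.
by rewrite expf_neq0 // pnatr_eq0.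
Qed.

(** E[H^2] = k contributes - b k, and the violated clauses, where H = - k, contribute 2^k b k 2^-k =
    b k. *)
Lemma EA_weight_balance s S : #|S| = k ->
  EA (fun rho => weight s (clause_of S rho) *
                 literal_balance s (clause_of S rho)) = 0.
Proof.
move=> Sk; have ss : \sum_(i in S) sg (s i == s i) = k%:R.
  by under eq_bigr do rewrite eqxx; rewrite sumr_const Sk.
rewrite (@eq_EA _ _ _ (fun rho => literal_balance s (clause_of S rho) +
   ((- b) * (literal_balance s (clause_of S rho) *
             literal_balance s (clause_of S rho)) +
    (2 ^+ k * b * k%:R) * violated s (clause_of S rho)))); last first.
  move=> rho; have := violated_balance s s S rho; rewrite ss => e.
  rewrite weight_clause_of // 2!mulrBl mul1r -[_ * violated _ _ * _]mulrA e.
  ring.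
rewrite !EAD !EAZ EA_balance EA_balance2 EA_violated // ss; field.
by rewrite expf_neq0 // pnatr_eq0.
Qed.

Lemma EA_weight2 s t S : #|S| = k ->
  EA (fun rho => weight s (clause_of S rho) * weight t (clause_of S rho)) =
  1 - 2 * b - b ^+ 2 * \sum_(i in S) sg (s i == t i)
  + 2 ^+ k * b ^+ 2 * (S \subset agreement s t)%:R.
Proof.
move=> Sk; set Y := \sum_(i in S) _.
have Yts : \sum_(i in S) sg (t i == s i) = Y.
  by apply: eq_bigr => i _; rewrite eq_sym.
pose H u rho := literal_balance u (clause_of S rho).
pose F u rho := violated u (clause_of S rho).
rewrite (@eq_EA _ _ _ (fun rho => 1 + ((- b) * H s rho + ((- b) * H t rho
   + (b ^+ 2 * (H s rho * H t rho) + ((- (2 ^+ k * b) - 2 ^+ k * b ^+ 2 * Y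
      + (2 ^+ k * b) ^+ 2 * (S \subset agreement s t)%:R) * F s rho
   + (- (2 ^+ k * b) - 2 ^+ k * b ^+ 2 * Y) * F t rho)))))); last first.
  move=> rho; rewrite !weight_clause_of //.
  have := violated_balance s t S rho; have := violated_balance t s S rho.
  have := violated2 s t S rho.
  rewrite Yts -/Y -/(H s rho) -/(H t rho) -/(F s rho) -/(F t rho).
  move: (H s rho) (H t rho) (F s rho) (F t rho) => hs ht fs ft e1 e2 e3.
  transitivity (1 - b * hs - b * ht + b ^+ 2 * (hs * ht) - 2 ^+ k * b * fs
    - 2 ^+ k * b * ft + 2 ^+ k * b ^+ 2 * (fs * ht)
    + 2 ^+ k * b ^+ 2 * (ft * hs) + (2 ^+ k * b) ^+ 2 * (fs * ft)).
    by ring.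
  by rewrite e1 e2 e3; ring.
rewrite !EAD !EAZ EA_cst !EA_balance EA_balance2 !EA_violated // -/Y.
by field; rewrite expf_neq0 // pnatr_eq0.
Qed.

Hypotheses (n_gt0 : (0 < n)%N) (k_le_n : (k <= n)%N).

Let binN0 : 'C(n, k)%:R != 0 :> R.
Proof. by rewrite pnatr_eq0 -lt0n bin_gt0. Qed.

Let sum_draws_cst (a : R) :
  \sum_(S : {set 'I_n} | #|S| == k) a = a * 'C(n, k)%:R.
Proof.
rewrite sumr_const -[LHS]mulr_natr; congr (_ * _%:R).
rewrite -[X in 'C(X, _)]card_ord -card_draws.
by apply: eq_card => S; rewrite !inE.
Qed.

Lemma avg_violated s : avg (kclauses k n) (violated s) = 2 ^- k.
Proof.
rewrite avg_kclauses (eq_bigr (fun=> 2 ^- k)) => [|S /eqP Sk].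
  by rewrite sum_draws_cst mulfK.
by rewrite EA_violated.
Qed.

Lemma avg_weight s : avg (kclauses k n) (weight s) = 1 - b.
Proof.
rewrite avg_kclauses (eq_bigr (fun=> 1 - b)) => [|S /eqP Sk].
  by rewrite sum_draws_cst mulfK.
by rewrite EA_weight.
Qed.

Lemma avg_weight_balance s :
  avg (kclauses k n) (fun C => weight s C * literal_balance s C) = 0.
Proof.
rewrite avg_kclauses (eq_bigr (fun=> 0)) => [|S /eqP Sk].
  by rewrite sum_draws_cst !mul0r.
by rewrite EA_weight_balance.
Qed.

Lemma card_draws_agreement s t :
  (\sum_(S : {set 'I_n} | #|S| == k) (S \subset agreement s t)%:R : R) =
  'C(#|agreement s t|, k)%:R.
Proof.
rewrite -cards_draws -sum1_card natr_sum [RHS]big_mkcond [LHS]big_mkcond.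
apply: eq_bigr => S _; rewrite !inE andbC.
by case: (#|S| == k); case: (S \subset _).
Qed.

(** The agreement set has n (1 + x) / 2 elements, so a random k-set lies inside it with probability
    at most ((1 + x) / 2)^k. Subtracting the term k x from the balances leaves an excess of second
    order at x = 0. *)
Lemma avg_weight2 s t x : x = overlap s t / n%:R ->
  avg (kclauses k n) (fun C => weight s C * weight t C) <=
  (1 - b) ^+ 2 + b ^+ 2 * ((1 + x) ^+ k - 1 - k%:R * x).
Proof.
move=> xE; rewrite avg_kclauses.
rewrite (eq_bigr (fun S : {set 'I_n} => (1 - 2 * b) +
   ((- b ^+ 2) * (\sum_(i in S) sg (s i == t i)) +
    2 ^+ k * b ^+ 2 * (S \subset agreement s t)%:R))); last first.
  by move=> S /eqP Sk; rewrite EA_weight2 //; ring.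
rewrite big_split sum_draws_cst big_split /= -!mulr_sumr card_draws_agreement.
have n0 : n%:R != 0 :> R by rewrite pnatr_eq0 -lt0n.
have -> : \sum_(S : {set 'I_n} | #|S| == k) \sum_(i in S) sg (s i == t i) =
   k%:R * 'C(n, k)%:R * x.
  apply: (mulfI n0); rewrite sum_draws xE /overlap; field; exact: n0.
have dn : (#|agreement s t| <= n)%N.
  by rewrite -[leqRHS]card_ord max_card.
have := bin_ratioR R dn k_le_n n_gt0.
have -> : (1 + x) ^+ k = 2 ^+ k * (#|agreement s t|%:R / n%:R) ^+ k.
  by rewrite -exprMn; congr (_ ^+ _); rewrite xE overlapE; field; exact: n0.
set D := 'C(#|_|, k)%:R => hD.
have -> : ((1 - 2 * b) * 'C(n, k)%:R + (- b ^+ 2 * (k%:R * 'C(n, k)%:R * x)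
   + 2 ^+ k * b ^+ 2 * D)) / 'C(n, k)%:R =
   (1 - b) ^+ 2 + b ^+ 2 * (2 ^+ k * (D / 'C(n, k)%:R) - 1 - k%:R * x).
  by field; exact: binN0.
rewrite lerD2l ler_wpM2l ?sqr_ge0 // !lerD2r ler_wpM2l //.
Qed.

End ClauseWeights.

(** * The overlap rate function *)

Section SecondMomentRate.
Variable R : realType.
Implicit Types (x t h c Lam : R) (k : nat).

Definition bracket k x : R := (1 + x) ^+ k - 1 - k%:R * x.

Lemma bracketS k x : bracket k.+1 x = (1 + x) * bracket k x + k%:R * x ^+ 2.
Proof. by rewrite /bracket exprS -natr1; ring. Qed.

Lemma bracket0 x : bracket 0 x = 0.
Proof. by rewrite /bracket expr0; ring. Qed.

Lemma bracket_ge0 k x : -1 <= x -> 0 <= bracket k x.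
Proof.
move=> x1; elim: k => [|k IH]; first by rewrite bracket0.
rewrite bracketS addr_ge0 //; last by rewrite mulr_ge0 ?sqr_ge0 ?ler0n.
by rewrite mulr_ge0 //; lra.
Qed.

Lemma bracket_le_half k x : -1 <= x <= 2^-1 ->
  bracket k x <= 4 * (3 / 2) ^+ k * x ^+ 2.
Proof.
move=> /andP[x1 x2].
(* The coefficient solves a(k+1) = (3/2) a(k) + k with a(0) = 0, which is the recursion of
   [bracketS] with 1 + x replaced by its maximum. *)
suff h : bracket k x <= (4 * (3 / 2) ^+ k - 2 * k%:R - 4) * x ^+ 2.
  apply: le_trans h _; rewrite ler_wpM2r ?sqr_ge0 //.
  have := ler0n R k; lra.
elim: k => [|k IH]; first by rewrite bracket0 expr0; lra.
rewrite bracketS.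
have b0 := bracket_ge0 k x1.
apply: (@le_trans _ _ (3 / 2 * bracket k x + k%:R * x ^+ 2)).
  by rewrite lerD2r ler_wpM2r //; lra.
rewrite -[k.+1%:R]natr1 [_ ^+ k.+1]exprS; move: IH b0; set u := (3 / 2) ^+ k.
by move: (bracket k x) (k%:R : R) u => y z u; nra.
Qed.

Lemma bracket_le_one k x : -1 <= x <= 1 -> bracket k x <= 2 ^+ k * x ^+ 2.
Proof.
move=> /andP[x1 x2].
(* Here the coefficient solves a(k+1) = 2 a(k) + k with a(0) = 0. *)
suff h : bracket k x <= (2 ^+ k - k%:R - 1) * x ^+ 2.
  apply: le_trans h _; rewrite ler_wpM2r ?sqr_ge0 //.
  have := ler0n R k; lra.
elim: k => [|k IH]; first by rewrite bracket0 expr0; lra.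
rewrite bracketS.
have b0 := bracket_ge0 k x1.
apply: (@le_trans _ _ (2 * bracket k x + k%:R * x ^+ 2)).
  by rewrite lerD2r ler_wpM2r //; lra.
rewrite -[k.+1%:R]natr1 [_ ^+ k.+1]exprS; move: IH b0; set u := 2 ^+ k.
by move: (bracket k x) (k%:R : R) u => y z u; nra.
Qed.

Lemma bernoulli_exp (a : R) k : 0 <= a -> 1 + k%:R * a <= (1 + a) ^+ k.
Proof.
move=> a0; have := @bracket_ge0 k a; rewrite /bracket; lra.
Qed.

(** From exp t <= 1 / (1 - t), cosh t is at most 1 / (1 - t^2) <= 1 + 2 t^2. *)
Lemma cosh_le_expR t : t ^+ 2 <= 2^-1 ->
  (expR t + expR (- t)) / 2 <= expR (2 * t ^+ 2).
Proof.
move=> t2.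
have t1 : t < 1 by nra.
have t1' : - 1 < t by nra.
have e1 : expR t <= (1 - t)^-1.
  rewrite -[leLHS]invrK -expRN lef_pV2 ?posrE ?expR_gt0 ?subr_gt0 //.
  exact: expR_ge1Dx.
have e2 : expR (- t) <= (1 + t)^-1.
  rewrite expRN lef_pV2 ?posrE ?expR_gt0 ?expR_ge1Dx //; lra.
apply: le_trans (expR_ge1Dx _).
have e3 : ((1 - t)^-1 + (1 + t)^-1) / 2 = (1 - t ^+ 2)^-1.
  by field; rewrite !gt_eqF //; nra.
have : (1 - t ^+ 2)^-1 <= 1 + 2 * t ^+ 2.
  have p : 0 < 1 - t ^+ 2 by lra.
  rewrite -(ler_pM2r p) mulVf ?gt_eqF //; have := sqr_ge0 t; nra.
lra.
Qed.

Lemma expR1_ge2 : 2 <= expR (1 : R).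
Proof. by have := expR_ge1Dx (1 : R); lra. Qed.

Lemma ln2_bounds : 2^-1 <= ln (2 : R) <= 1.
Proof.
apply/andP; split.
  rewrite -ler_expR lnK ?posrE //.
  have h : expR (2^-1 : R) = (expR (- 2^-1))^-1 by rewrite expRN invrK.
  rewrite h -[leRHS]invrK lef_pV2 ?posrE ?expR_gt0 ?invr_gt0 //.
  by have := expR_ge1Dx (- 2^-1 : R); lra.
by rewrite -ler_expR lnK ?posrE // expR1_ge2.
Qed.

(** Per-variable Chernoff bound with tilt t for pairs at overlap x, multiplied by their
    second-moment factor. The gain in entropy has to beat [Lam * bracket k x], which is dangerous
    only near x = 1, where entropy ln 2 faces Lam 2^k <= ln 2 - 22 h. *)
Lemma exists_chernoff_rate k h Lam x :
  0 < h -> h <= 100^-1 -> h ^+ 2 * k.+1%:R = 1 ->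
  0 <= Lam -> Lam * 2 ^+ k <= ln 2 - 22 * h -> -1 <= x <= 1 ->
  exists t, (expR t + expR (- t)) / 2 * expR (- (t * x)) *
            expR (Lam * bracket k x) <= expR (- (h ^+ 2 * x ^+ 2)).
Proof.
move=> h0 h1 hk L0 L1 /andP[x1 x2].
have /andP[l1 l2] := ln2_bounds.
have hh : h ^+ 2 <= 64^-1 by nra.
have hh0 : 0 < h ^+ 2 by rewrite exprn_gt0.
have k0 := ler0n R k.
have kbig : 200 <= k%:R :> R.
  have hb : h ^+ 2 <= 201^-1 by nra.
  have := ler_wpM2r (ler0n R k.+1) hb; rewrite hk -[k.+1%:R]natr1; lra.
have p2 : 0 < 2 ^+ k :> R by rewrite exprn_gt0.
have LL : Lam * 2 ^+ k <= 1.
  by clear -L1 l2 h0; move: (Lam * _) L1 => z; lra.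
have [xh|xh] := leP x 2^-1.
  (* This tilt yields exponent 2 (x / 4)^2 - x^2 / 4 = - x^2 / 8, while the bracket term stays below
     x^2 / 16. *)
  exists (x / 4).
  have c1 : (expR (x / 4) + expR (- (x / 4))) / 2 <= expR (2 * (x / 4) ^+ 2).
    by apply: cosh_le_expR; clear -x1 x2; nra.
  apply: (@le_trans _ _ (expR (2 * (x / 4) ^+ 2) * expR (- (x / 4 * x)) *
     expR (Lam * bracket k x))).
    by rewrite !ler_wpM2r // expR_ge0.
  rewrite -!expRD ler_expR.
  have br : bracket k x <= 4 * (3 / 2) ^+ k * x ^+ 2.
    by apply: bracket_le_half; rewrite x1.
  have q : 64 * (3 / 2) ^+ k <= 2 ^+ k :> R.
    have -> : 2 ^+ k = (1 + 3^-1) ^+ k * (3 / 2) ^+ k :> R.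
      by rewrite -exprMn; congr (_ ^+ _); field.
    rewrite ler_wpM2r ?exprn_ge0 //.
    have := @bernoulli_exp 3^-1 k; clear -kbig; move: ((1 + 3^-1) ^+ k) => z; lra.
  have q2 : Lam * (4 * (3 / 2) ^+ k) <= 16^-1.
    by have := ler_wpM2l L0 q; clear -LL; move: ((3 / 2) ^+ k) (2 ^+ k) LL => u v; lra.
  have := ler_wpM2l L0 br; rewrite mulrA.
  have := ler_wpM2r (sqr_ge0 x) q2; have := ler_wpM2r (sqr_ge0 x) hh.
  have := sqr_ge0 x; clear; move: (Lam * _) (Lam * _) => u v; lra.
have br : bracket k x <= (1 + x) ^+ k.
  have : 0 <= k%:R * x by rewrite mulr_ge0 //; lra.
  by rewrite /bracket; clear; move: (_ ^+ k) (k%:R * x) => u v; lra.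
have [xu|xu] := leP x (1 - 20 * h ^+ 2).
  exists (x / 4).
  have c1 : (expR (x / 4) + expR (- (x / 4))) / 2 <= expR (2 * (x / 4) ^+ 2).
    by apply: cosh_le_expR; clear -x1 x2; nra.
  apply: (@le_trans _ _ (expR (2 * (x / 4) ^+ 2) * expR (- (x / 4 * x)) *
     expR (Lam * bracket k x))).
    by rewrite !ler_wpM2r // expR_ge0.
  rewrite -!expRD ler_expR.
  have e1 : (1 + x) ^+ k <= 2 ^+ k * 2 ^- 9.
    have -> : (1 + x) ^+ k = 2 ^+ k * ((1 + x) / 2) ^+ k.
      by rewrite -exprMn; congr (_ ^+ _); field.
    rewrite ler_pM2l //.
    (* (1 + x) / 2 <= 1 - 10 h^2, and 10 h^2 k = 10 - 10 h^2 >= 9, so the k-th power is at most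
       exp(- 9) <= 2^-9. *)
    apply: (@le_trans _ _ (expR (- (10 * h ^+ 2)) ^+ k)).
      rewrite lerXn2r ?nnegrE ?expR_ge0 //; first by lra.
      by apply: le_trans (expR_ge1Dx _); lra.
    rewrite -expRM_natl.
    apply: (@le_trans _ _ (expR (9%:R * -1))).
      rewrite ler_expR; move: hk; rewrite -[k.+1%:R]natr1; clear -hh k0; nra.
    rewrite expRM_natl expRN exprVn lef_pV2 ?posrE ?exprn_gt0 ?expR_gt0 //.
    by apply: lerXn2r; rewrite ?nnegrE ?expR_ge0 ?expR1_ge2.
  have : Lam * bracket k x <= 128^-1.
    apply: (@le_trans _ _ (Lam * (2 ^+ k * 2 ^- 9))).
      by rewrite ler_wpM2l // (le_trans br).
    rewrite mulrA; apply: (@le_trans _ _ (2 ^- 9)).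
      by rewrite ler_piMl // invr_ge0 exprn_ge0.
    by rewrite lef_pV2 ?posrE ?exprn_gt0 // -natrX ler_nat.
  by clear -hh hh0 xh x2; move: (Lam * _) => z; nra.
have hN0 : h != 0 by rewrite gt_eqF.
have hV : 0 < h^-1 by rewrite invr_gt0.
(* A large tilt, making cosh t close to e^t / 2. As 1 - x < 20 h^2, the exponent is at most 20 h + h
   / 2 - ln 2, and the slack 22 h in [Lam] leaves at most - h. *)
exists h^-1.
have c1 : (expR h^-1 + expR (- h^-1)) / 2 <=
          expR (h^-1 + (h / 2) - ln 2).
  rewrite 2!expRD (expRN (ln 2)) lnK ?posrE // ler_pM2r ?invr_gt0 //.
  have -> : expR h^-1 + expR (- h^-1) = expR h^-1 * (1 + expR (- (2 * h^-1))).
    rewrite mulrDr mulr1 -expRD; congr (_ + expR _); ring.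
  rewrite ler_wpM2l ?expR_ge0 //; apply: le_trans (expR_ge1Dx _).
  rewrite lerD2l.
  apply: (@le_trans _ _ (1 + 2 * h^-1)^-1).
    rewrite expRN lef_pV2 ?posrE ?expR_gt0 ?expR_ge1Dx //; lra.
  have -> : h / 2 = (2 * h^-1)^-1 by field.
  by rewrite lef_pV2 ?posrE //; lra.
apply: (@le_trans _ _ (expR (h^-1 + (h / 2) - ln 2) * expR (- (h^-1 * x)) *
     expR (Lam * bracket k x))).
  by rewrite !ler_wpM2r // expR_ge0.
rewrite -!expRD ler_expR.
have e1 : Lam * bracket k x <= ln 2 - 22 * h.
  apply: le_trans L1; rewrite ler_wpM2l // (le_trans br) //.
  by rewrite lerXn2r ?nnegrE //; lra.
have e2 : h^-1 * (1 - x) <= 20 * h.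
  apply: (@le_trans _ _ (h^-1 * (20 * h ^+ 2))).
    by rewrite ler_pM2l //; lra.
  by rewrite mulrCA expr2 mulKf.
have : h ^+ 2 * x ^+ 2 <= h.
  apply: (@le_trans _ _ (h ^+ 2)); last by nra.
  by rewrite ler_piMr ?sqr_ge0 //; nra.
lra.
Qed.

End SecondMomentRate.

(** * Overlap tails *)

Section AssignmentAverages.
Variables (R : realType) (n : nat).
Implicit Types (f g : assignment n -> R).

Lemma ler_EA f g : (forall s, f s <= g s) -> EA f <= EA g.
Proof.
move=> h; rewrite /EA ler_wpM2r ?invr_ge0 ?exprn_ge0 //.
by apply: ler_sum.
Qed.

Lemma EA_ge0 f : (forall s, 0 <= f s) -> 0 <= EA f.
Proof. by move=> h; rewrite -(EA_cst n 0) ler_EA. Qed.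

Lemma EA_mul f g : EA f * EA g = EA (fun s => EA (fun t => f s * g t)).
Proof.
rewrite mulrC -EAZ; apply: eq_EA => s.
by rewrite mulrC -EAZ.
Qed.

Lemma avg_EA (T : finType) (A : {set T}) (f : assignment n -> T -> R) :
  avg A (fun C => EA (fun s => f s C)) = EA (fun s => avg A (f s)).
Proof.
rewrite /EA -avg_sum mulrC -avgZ; apply: eq_avg => C _.
by rewrite mulrC.
Qed.

Lemma Ex_EA (T : finType) (A : {set T}) j (f : assignment n -> seq T -> R) :
  Ex A j (fun c => EA (fun s => f s c)) = EA (fun s => Ex A j (f s)).
Proof.
rewrite /EA -Ex_sum mulrC -ExZ; apply: eq_Ex => c _ _.
by rewrite mulrC.
Qed.

Lemma overlap_bounds (s t : assignment n) : (0 < n)%N ->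
  -1 <= overlap R s t / n%:R <= 1.
Proof.
move=> n0; have n0' : 0 < n%:R :> R by rewrite ltr0n.
rewrite ler_pdivlMr // ler_pdivrMr // mulN1r mul1r overlapE.
have : #|agreement s t|%:R <= n%:R :> R.
  by rewrite ler_nat -[leqRHS]card_ord max_card.
have := ler0n R #|agreement s t|; lra.
Qed.

Lemma EA_expR_overlap (s : assignment n) (t : R) :
  EA (fun s' => expR (t * overlap R s s')) =
  ((expR t + expR (- t)) / 2) ^+ n.
Proof.
under eq_EA => s' do rewrite /overlap mulr_sumr expR_sum.
transitivity (EA (fun s' : assignment n =>
    \prod_(i in [set: 'I_n]) expR (t * sg R (s i == s' i)))).
  by apply: eq_EA => s'; apply: eq_bigl => i; rewrite inE.
rewrite (EA_prod [set: 'I_n] (fun i b => expR (t * sg R (s i == b)))).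
rewrite (eq_bigr (fun=> (expR t + expR (- t)) / 2)) => [|i _].
  by rewrite prodr_const cardsT card_ord.
by case: (s i); rewrite /sg /= mulr1 mulrN1 // addrC.
Qed.

Variables (k : nat) (h Lam : R).
Hypotheses (h_gt0 : 0 < h) (h_le : h <= 100^-1).
Hypothesis (hk : h ^+ 2 * k.+1%:R = 1).
Hypotheses (Lam_ge0 : 0 <= Lam) (Lam_le : Lam * 2 ^+ k <= ln 2 - 22 * h).
Hypothesis n_gt0 : (0 < n)%N.

(** The overlap takes at most n + 1 values. Each value gets its own Chernoff tilt, and the classes
    are summed. *)
Lemma overlap_tail (s : assignment n) (d : R) :
  EA (fun t => let x := overlap R s t / n%:R in
    (d < x ^+ 2)%R%:R * expR (n%:R * (Lam * bracket k x))) <=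
  n.+1%:R * expR (- (h ^+ 2 * n%:R * d)).
Proof.
have n0 : 0 < n%:R :> R by rewrite ltr0n.
have nN0 : n%:R != 0 :> R by rewrite gt_eqF.
pose cls t : 'I_n.+1 := inord #|agreement s t|.
pose X (v : 'I_n.+1) : R := (2 * v%:R - n%:R) / n%:R.
have clsE t v : cls t == v -> overlap R s t / n%:R = X v.
  move=> /eqP <-; rewrite /X overlapE /cls inordK // ltnS.
  by rewrite -[leqRHS]card_ord max_card.
rewrite /EA (partition_big cls xpredT) //= mulr_suml.
have -> : n.+1%:R * expR (- (h ^+ 2 * n%:R * d)) =
   \sum_(v < n.+1) expR (- (h ^+ 2 * n%:R * d)).
  by rewrite sumr_const card_ord mulr_natl.
apply: ler_sum => v _.
rewrite (eq_bigr (fun=> (d < X v ^+ 2)%R%:R *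
    expR (n%:R * (Lam * bracket k (X v))))); last first.
  by move=> t /clsE ->.
have [dX|dX] := ltP d (X v ^+ 2); last first.
  by rewrite big1 ?mul0r ?expR_ge0 // => t _; rewrite mulr0n mul0r.
have [t0 t0v|none] := pickP (fun t => cls t == v); last first.
  by rewrite big_pred0 ?mul0r ?expR_ge0.
have Xb : -1 <= X v <= 1 by rewrite -(clsE _ _ t0v) overlap_bounds.
have [t ht] := exists_chernoff_rate h_gt0 h_le hk Lam_ge0 Lam_le Xb.
(* On the class of v the inserted factor exp(t overlap - t n X(v)) is 1. Extending the sum to all
   assignments then makes the exponential moment factorize. *)
apply: (@le_trans _ _ (EA (fun t' => expR (n%:R * (Lam * bracket k (X v)))
   * expR (- (n%:R * (t * X v))) * expR (t * overlap R s t')))).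
  rewrite /EA ler_wpM2r ?invr_ge0 ?exprn_ge0 //.
  rewrite [leRHS](bigID (fun t' => cls t' == v)) /= -[leLHS]addr0.
  apply: lerD; last first.
    by apply: sumr_ge0 => t' _; rewrite !mulr_ge0 ?expR_ge0.
  apply: ler_sum => t' /clsE e; rewrite mulr1n mul1r -mulrA -expRD -e.
  have -> : - (n%:R * (t * (overlap R s t' / n%:R))) + t * overlap R s t' = 0.
    by field.
  by rewrite expR0 mulr1.
rewrite EAZ EA_expR_overlap.
have -> : - (n%:R * (t * X v)) = n%:R * - (t * X v) by rewrite mulrN.
rewrite !expRM_natl -!exprMn mulrC mulrA.
apply: (@le_trans _ _ (expR (- (h ^+ 2 * X v ^+ 2)) ^+ n)).
  rewrite lerXn2r ?nnegrE ?expR_ge0 //.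
  by rewrite [leLHS]mulrAC.
rewrite -expRM_natl ler_expR.
have -> : n%:R * - (h ^+ 2 * X v ^+ 2) = - (h ^+ 2 * n%:R * X v ^+ 2) by ring.
by rewrite lerN2 ler_wpM2l ?(ltW dX) // mulr_ge0 ?sqr_ge0 ?ltW.
Qed.

End AssignmentAverages.

(** * The weighted count stays large *)

Definition pow_dominates (R : realType) (k : nat) : Prop :=
  16 * k.+1%:R <= 2 ^+ k :> R.

Section WeightedCount.
Variables (R : realType) (k n : nat).
Implicit Types (s t : assignment n) (C : clause n) (c : seq (clause n)).
Hypotheses (n_gt0 : (0 < n)%N) (k_le_n : (k <= n)%N) (k_ge4 : (4 <= k)%N).
Hypothesis k_pow : pow_dominates R k.

Local Notation K := (kclauses k n).

Local Ltac lra_pow :=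
  have := k_pow; rewrite /pow_dominates -[k.+1%:R]natr1; have := ler0n R k;
  move: (2 ^+ k) (k%:R : R) => ? ?; lra.

Definition bal : R := (2 ^+ k - k%:R)^-1.

Lemma bal_gt0 : 0 < bal.
Proof. by rewrite /bal invr_gt0; lra_pow. Qed.

Lemma bal_balanced : 1 + bal * k%:R = 2 ^+ k * bal.
Proof.
have := bal_gt0; rewrite invr_gt0 => h; rewrite /bal; field.
by rewrite gt_eqF.
Qed.

Lemma bal_small : bal * k.+1%:R <= 8^-1.
Proof.
have := bal_gt0; rewrite /bal invr_gt0 => b0.
by rewrite mulrC ler_pdivrMr // -[k.+1%:R]natr1; lra_pow.
Qed.

Lemma bal_le : bal <= 8^-1.
Proof.
apply: le_trans bal_small; rewrite ler_pMr ?bal_gt0 //.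
by rewrite ler1n.
Qed.

Lemma balk_le : bal * k%:R <= 8^-1.
Proof.
apply: le_trans bal_small; rewrite ler_pM2l ?bal_gt0 //.
by rewrite ler_nat.
Qed.

Lemma literal_balance_le s C : C \in K -> `|literal_balance R s C| <= k%:R.
Proof.
rewrite inE => /andP[/eqP <- _]; apply: le_trans (ler_norm_sum _ _ _) _.
rewrite -sum1_card natr_sum.
by apply: ler_sum => l _; case: eqP => _; rewrite /sg ?normrN normr1.
Qed.

Definition nweight s C : R := weight bal s C / (1 - bal).

Lemma weight_bounds s C : C \in K ->
  7 / 8 * (sat_clause s C)%:R <= weight bal s C <= 2.
Proof.
move=> CK; have := literal_balance_le s CK; rewrite ler_norml => /andP[h1 h2].
have := ler_wpM2l (ltW bal_gt0) h1; have := ler_wpM2l (ltW bal_gt0) h2.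
have := balk_le; rewrite /weight mulrN.
by case: sat_clause; rewrite ?mulr1n ?mulr0n ?mulr1 ?mulr0; lra.
Qed.

Lemma nweight_ge s C : C \in K ->
  7 / 8 * (sat_clause s C)%:R <= nweight s C.
Proof.
move=> CK; have /andP[h _] := weight_bounds s CK; have := bal_le.
have := bal_gt0 => b0 b1.
rewrite /nweight ler_pdivlMr; last by lra.
apply: le_trans h; rewrite ler_piMr ?mulr_ge0 //; lra.
Qed.

Lemma nweight_ge0 s C : C \in K -> 0 <= nweight s C.
Proof. by move=> CK; apply: le_trans (nweight_ge s CK); rewrite mulr_ge0. Qed.

Lemma avg_nweight s : avg K (nweight s) = 1.
Proof.
have := bal_le => b1.
rewrite (@eq_avg _ _ _ _ (fun C => (1 - bal)^-1 * weight bal s C)); last first.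
  by move=> C _; rewrite mulrC.
rewrite avgZ avg_weight ?bal_balanced //; apply: mulVf.
by rewrite gt_eqF //; lra.
Qed.

Definition norm_bal : R := bal / (1 - bal).

Lemma avg_nweight2 s t x : x = overlap R s t / n%:R ->
  avg K (fun C => nweight s C * nweight t C) <= 1 + norm_bal ^+ 2 * bracket k x.
Proof.
move=> xE; have := bal_le => b1; have b2 : 0 < 1 - bal by lra.
rewrite (@eq_avg _ _ _ _ (fun C => (1 - bal) ^- 2 *
   (weight bal s C * weight bal t C))); last first.
  by move=> C _; rewrite /nweight; field; rewrite gt_eqF.
rewrite avgZ -(ler_pM2l (exprn_gt0 2 b2)) mulVKf ?gt_eqF ?exprn_gt0 //.
apply: le_trans (avg_weight2 bal_balanced n_gt0 k_le_n xE) _.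
rewrite le_eqVlt; apply/orP; left; apply/eqP; rewrite /bracket /norm_bal.
by field; rewrite gt_eqF.
Qed.

Lemma norm_balE : norm_bal = (2 ^+ k - k%:R - 1)^-1.
Proof.
have := bal_gt0; rewrite /norm_bal /bal invr_gt0 => h; field.
by rewrite !gt_eqF //; lra_pow.
Qed.

Lemma norm_bal2_le : norm_bal ^+ 2 * 2 ^+ k <= 1.
Proof.
have p : 1 <= 2 ^+ k :> R by rewrite exprn_ege1 // ler1n.
have q : 0 < 2 ^+ k - k%:R - 1 :> R.
  lra_pow.
rewrite norm_balE exprVn mulrC ler_pdivrMr ?exprn_gt0 // mul1r.
have : 15 / 16 * 2 ^+ k <= 2 ^+ k - k%:R - 1 :> R.
  lra_pow.
have : 16 <= 2 ^+ k :> R.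
  by apply: le_trans k_pow; rewrite ler_peMr // ler1n.
by move: q p; move: (2 ^+ k) (2 ^+ k - k%:R - 1) => z y *; nra.
Qed.

Definition wprod s c : R := \prod_(C <- c) nweight s C.

(** This is L: the clause weights are normalized to mean one, so averaging over assignments gives
    expectation one. *)
Definition wcount c : R := EA (fun s => wprod s c).

Lemma wprod_ge0 s c : all (mem K) c -> 0 <= wprod s c.
Proof.
elim: c => [|C c IH] /=; first by rewrite /wprod big_nil.
by move=> /andP[CK cK]; rewrite /wprod big_cons mulr_ge0 ?IH ?nweight_ge0.
Qed.

Lemma wprod_cons s C c : wprod s (C :: c) = nweight s C * wprod s c.
Proof. by rewrite /wprod big_cons. Qed.

Lemma wcount_nil : wcount [::] = 1.
Proof.
rewrite /wcount -[RHS](@EA_cst _ n); apply: eq_EA => s; by rewrite /wprod big_nil.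
Qed.

Lemma wcount_ge0 c : all (mem K) c -> 0 <= wcount c.
Proof. by move=> cK; apply: EA_ge0 => s; apply: wprod_ge0. Qed.

Lemma wcount_martingale c : avg K (fun C => wcount (C :: c)) = wcount c.
Proof.
rewrite avg_EA; apply: eq_EA => s.
rewrite (@eq_avg _ _ _ _ (fun C => wprod s c * nweight s C)); last first.
  by move=> C _; rewrite wprod_cons mulrC.
by rewrite avgZ avg_nweight mulr1.
Qed.

Definition ov s t : R := overlap R s t / n%:R.

Definition far_mass (d : R) c : R :=
  EA (fun s => EA (fun t => (d < ov s t ^+ 2)%R%:R * (wprod s c * wprod t c))).

Lemma far_mass_ge0 d c : all (mem K) c -> 0 <= far_mass d c.
Proof.
move=> cK; apply: EA_ge0 => s; apply: EA_ge0 => t.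
by rewrite mulr_ge0 // mulr_ge0 ?wprod_ge0.
Qed.

Lemma wcount2E c : wcount c ^+ 2 = EA (fun s => EA (fun t => wprod s c * wprod t c)).
Proof. by rewrite expr2 EA_mul. Qed.

Lemma ov_bounds s t : -1 <= ov s t <= 1.
Proof. exact: overlap_bounds. Qed.

(** Near pairs are bounded by y and far ones by 1. Taken with phi = x^2 for the variance of a step
    and with phi = x for the magnetizations. *)
Lemma pair_average_le (phi : R -> R) (d y : R) c : all (mem K) c ->
  (forall x, -1 <= x <= 1 -> x ^+ 2 <= d -> phi x <= y) ->
  (forall x, -1 <= x <= 1 -> phi x <= 1) -> 0 <= y ->
  EA (fun s => EA (fun t => phi (ov s t) * (wprod s c * wprod t c))) <=
  y * wcount c ^+ 2 + far_mass d c.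
Proof.
move=> cK h1 h2 y0; rewrite wcount2E /far_mass -EAZ -EAD; apply: ler_EA => s.
rewrite -EAZ -EAD; apply: ler_EA => t; rewrite -mulrDl ler_wpM2r //.
  by rewrite mulr_ge0 ?wprod_ge0.
have [h|h] := ltP d (ov s t ^+ 2).
  by rewrite mulr1n; have := h2 _ (ov_bounds s t); lra.
by rewrite mulr0n addr0 h1 ?ov_bounds.
Qed.

(** The conditional variance is the pair average of E[w w'] - 1, which is at most
    [norm_bal ^+ 2 * 2 ^+ k] times the squared overlap because the excess has no linear term. *)
Lemma avg_wcount2 c : all (mem K) c ->
  avg K (fun C => (wcount (C :: c) - wcount c) ^+ 2) <=
  EA (fun s => EA (fun t => ov s t ^+ 2 * (wprod s c * wprod t c))).
Proof.
move=> cK.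
rewrite (@eq_avg _ _ _ _ (fun C => wcount (C :: c) ^+ 2 +
   ((- (2 * wcount c)) * wcount (C :: c) + wcount c ^+ 2))); last by move=> C _; ring.
rewrite !avgD avgZ wcount_martingale avg_cst; last first.
  by rewrite (card_kclauses R) muln_gt0 expn_gt0 bin_gt0.
have -> : avg K (fun C => wcount (C :: c) ^+ 2) = EA (fun s => EA (fun t =>
   avg K (fun C => nweight s C * nweight t C) * (wprod s c * wprod t c))).
  rewrite (@eq_avg _ _ _ _ (fun C => EA (fun s => EA (fun t =>
     wprod s (C :: c) * wprod t (C :: c))))) => [|C _]; last exact: wcount2E.
  rewrite avg_EA; apply: eq_EA => s; rewrite avg_EA; apply: eq_EA => t.
  rewrite mulrC -avgZ; apply: eq_avg => C _; rewrite !wprod_cons; ring.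
have -> : - (2 * wcount c) * wcount c + wcount c ^+ 2 = - wcount c ^+ 2 by ring.
rewrite lerBlDr wcount2E -EAD; apply: ler_EA => s.
rewrite -EAD; apply: ler_EA => t.
have -> : ov s t ^+ 2 * (wprod s c * wprod t c) + wprod s c * wprod t c =
   (1 + ov s t ^+ 2) * (wprod s c * wprod t c) by ring.
rewrite ler_wpM2r //; first by rewrite mulr_ge0 ?wprod_ge0.
apply: le_trans (avg_nweight2 (erefl (ov s t))) _; rewrite lerD2l.
apply: le_trans (ler_wpM2l (sqr_ge0 _) (bracket_le_one k (ov_bounds s t))) _.
by rewrite mulrA ler_piMl ?sqr_ge0 ?norm_bal2_le.
Qed.

(** Not divided by [wcount c]: the mean spin of variable i under the weighted measure is the
    quotient. In [biased] that mean is at least 1/2 in absolute value. *)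
Definition magnetization (i : 'I_n) c : R := EA (fun s => sg R (s i) * wprod s c).

(** The square of a mean spin is a product over two independent replicas, and summing over variables
    produces their overlap. *)
Lemma sum_magnetization2 c : \sum_i magnetization i c ^+ 2 =
  n%:R * EA (fun s => EA (fun t => ov s t * (wprod s c * wprod t c))).
Proof.
under eq_bigr => i _ do rewrite expr2 EA_mul.
rewrite -EA_sum -EAZ; apply: eq_EA => s.
rewrite -EA_sum -EAZ; apply: eq_EA => t.
have n0 : n%:R != 0 :> R by rewrite pnatr_eq0 -lt0n.
rewrite mulrA /ov [n%:R * _]mulrC divfK // /overlap mulr_suml.
apply: eq_bigr => i _; rewrite mulrACA; congr (_ * _).
by case: (s i); case: (t i); rewrite /sg /= ?mulrNN ?mulr1 ?mul1r.
Qed.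

Definition biased c : {set 'I_n} := [set i | wcount c ^+ 2 <= 4 * magnetization i c ^+ 2].

(** Weights of satisfied clauses are at least 7/8, so the mass Y satisfying C is below L / 7 and the
    mass V violating it is above 6 L / 7. All literals are false on V, so each has mean sign at most
    (Y - V) / L < - 5/7. *)
Lemma kill_biased c C : all (mem K) c -> C \in K -> 8 * wcount (C :: c) < wcount c ->
  [set l.1 | l in C] \subset biased c.
Proof.
move=> cK CK hL; apply/fintype.subsetP => i /imsetP[[i' a] iaC /= ->{i}].
pose V := EA (fun s => violated R s C * wprod s c).
pose Y := EA (fun s => (sat_clause s C)%:R * wprod s c).
have YV : Y + V = wcount c.
  rewrite /Y /V -EAD; apply: eq_EA => s; rewrite -mulrDl /violated.
  by case: sat_clause; rewrite /= ?mulr1n ?mulr0n ?addr0 ?add0r mul1r.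
have hY : 7 / 8 * Y <= wcount (C :: c).
  rewrite -EAZ; apply: ler_EA => s; rewrite wprod_cons mulrA ler_wpM2r ?wprod_ge0 //.
  exact: nweight_ge.
have hM : EA (fun s => sg R (s i' == a) * wprod s c) <= Y - V.
  rewrite -[- V]mulN1r -EAZ -EAD; apply: ler_EA => s.
  rewrite mulrA -mulrDl ler_wpM2r ?wprod_ge0 // /violated.
  case hs : (sat_clause s C); rewrite /= ?mulr1n ?mulr0n ?mulr0 ?mulr1 ?addr0 ?add0r.
    by case: (s i' == a); rewrite /sg; lra.
  case e: (s i' == a) => //=; move: hs => /negbT/negP; case.
  by rewrite /sat_clause; apply/existsP; exists (i', a); rewrite iaC /= e.
have L0 := wcount_ge0 cK.
have mE : magnetization i' c ^+ 2 = EA (fun s => sg R (s i' == a) * wprod s c) ^+ 2.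
  have [e|e] : EA (fun s => sg R (s i' == a) * wprod s c) = magnetization i' c \/
               EA (fun s => sg R (s i' == a) * wprod s c) = - magnetization i' c.
  - case: (a); [left|right; rewrite /magnetization -mulN1r -EAZ]; apply: eq_EA => s.
      by case: (s i').
    by case: (s i'); rewrite /sg /=; ring.
  - by rewrite e.
  by rewrite e sqrrN.
rewrite inE mE; move: hM; move: (EA _) => z hz.
have z1 : z <= - (5 / 7 * wcount c) by lra.
have : (5 / 7 * wcount c) ^+ 2 <= z ^+ 2.
  move: z1 L0; move: (wcount c) => y z1 y0.
  have p : 0 <= - z - 5 / 7 * y by lra.
  have q : 0 <= - z + 5 / 7 * y by lra.
  by have := mulr_ge0 p q; lra.
by have := sqr_ge0 (wcount c); move: (wcount c) => y; lra.
Qed.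

Lemma avg_vars_subset (B : {set 'I_n}) :
  avg K (fun C => ([set l.1 | l in C] \subset B)%:R) <=
  (#|B|%:R / n%:R) ^+ k :> R.
Proof.
rewrite avg_kclauses.
rewrite (eq_bigr (fun S : {set 'I_n} => (S \subset B)%:R)); last first.
  move=> S _; rewrite -[RHS](@EA_cst _ n); apply: eq_EA => rho.
  by rewrite vars_clause_of.
apply: le_trans (bin_ratioR R _ k_le_n n_gt0); last first.
  by rewrite -[leqRHS]card_ord max_card.
rewrite ler_pM2r ?invr_gt0 ?ltr0n ?bin_gt0 // -cards_draws -sum1_card natr_sum.
rewrite [leLHS]big_mkcond [leRHS]big_mkcond.
apply: ler_sum => S _; rewrite !inE andbC.
by case: (#|S| == k); case: (S \subset _).
Qed.

(** * The step estimates up to m clauses *)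

Section Bounds.
Variables (h Lam : R) (m : nat) (g : nat -> R) (z : R).
Hypotheses (h_gt0 : 0 < h) (h_le : h <= 100^-1).
Hypothesis (hk : h ^+ 2 * k.+1%:R = 1).
Hypotheses (Lam_ge0 : 0 <= Lam) (Lam_le : Lam * 2 ^+ k <= ln 2 - 22 * h).
Hypothesis m_le : m%:R * norm_bal ^+ 2 <= n%:R * Lam.
Hypothesis g0_ge0 : 0 <= g 0%N.

(** Chosen so that [overlap_tail] gives (n + 1) exp(- 4 g); Markov's inequality at the level exp(- 3
    g) of [flat_overlap] then leaves (n + 1) exp(- g). *)
Definition overlap_thr (j : nat) : R := 4 * g j / (h ^+ 2 * n%:R).

Hypothesis g_step :
  forall j, 8 * (overlap_thr j + expR (- g j)) <= g j.+1 - g j.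
Hypothesis z_ge : forall j, (j < m)%N ->
  4 * (Num.sqrt (overlap_thr j) + expR (- g j)) <= z.
Hypotheses (z_ge0 : 0 <= z) (z_le1 : z <= 1).

Let hn_gt0 : 0 < h ^+ 2 * n%:R.
Proof. by rewrite mulr_gt0 ?exprn_gt0 ?ltr0n. Qed.

Lemma g_ge_g0 j : g 0%N <= g j.
Proof.
elim: j => // j IH; have := g_step j; have := expR_ge0 (- g j).
have : 0 <= overlap_thr j.
  by rewrite divr_ge0 ?(ltW hn_gt0) // mulr_ge0 // (le_trans g0_ge0).
lra.
Qed.

Lemma overlap_thr_ge0 j : 0 <= overlap_thr j.
Proof.
by rewrite divr_ge0 ?(ltW hn_gt0) // mulr_ge0 // (le_trans g0_ge0) // g_ge_g0.
Qed.

(** The level exp(- 3 g) is a factor exp(- g) below L^2 whenever L >= exp(- g). This is the event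
    [O] of the martingale argument. *)
Definition flat_overlap c : bool :=
  far_mass (overlap_thr (size c)) c <= expR (- (3 * g (size c))).

(** Clauses are independent, so the pair average is raised to the power j; [m_le] turns the number
    of clauses into the rate [Lam] per variable. *)
Lemma Ex_wprod2 j s t : (j <= m)%N ->
  Ex K j (fun c => wprod s c * wprod t c) <= expR (n%:R * (Lam * bracket k (ov s t))).
Proof.
move=> jm.
rewrite (@eq_Ex _ _ _ _ _ (fun c => \prod_(C <- c) (nweight s C * nweight t C))).
  rewrite Ex_prod.
  have br0 : 0 <= bracket k (ov s t).
    by apply: bracket_ge0; have /andP[] := ov_bounds s t.
  apply: (@le_trans _ _ (expR (norm_bal ^+ 2 * bracket k (ov s t)) ^+ j)).
    rewrite lerXn2r ?nnegrE ?expR_ge0 //.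
      by apply: avg_ge0 => C CK; rewrite mulr_ge0 ?nweight_ge0.
    apply: le_trans (avg_nweight2 (erefl (ov s t))) _; exact: expR_ge1Dx.
  rewrite -expRM_natl ler_expR [leLHS]mulrA [leRHS]mulrA ler_wpM2r //.
  apply: le_trans m_le.
  by rewrite ler_wpM2r ?sqr_ge0 // ler_nat.
by move=> c _ _; rewrite /wprod -big_split.
Qed.

Lemma flat_tail j : (j < m)%N ->
  Ex K j (fun c => (~~ flat_overlap c)%:R) <= n.+1%:R * expR (- g 0%N).
Proof.
move=> jm.
have K0 : (0 < #|K|)%N by rewrite (card_kclauses R) muln_gt0 expn_gt0 bin_gt0.
rewrite (@eq_Ex _ _ _ _ _
   (fun c => (expR (- (3 * g j)) < far_mass (overlap_thr j) c)%R%:R)); last first.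
  by move=> c cj _; rewrite /flat_overlap cj -ltNge.
apply: le_trans (@Ex_markov _ _ _ _ _ _ (expR_gt0 _) _) _.
  by move=> c _ cK; apply: far_mass_ge0.
rewrite ler_pdivrMr ?expR_gt0 // -mulrA -expRD.
apply: (@le_trans _ _ (n.+1%:R * expR (- (4 * g j)))); last first.
  by rewrite ler_wpM2l // ler_expR; have := g_ge_g0 j; lra.
rewrite Ex_EA -[leRHS](@EA_cst _ n); apply: ler_EA => s.
have -> : - (4 * g j) = - (h ^+ 2 * n%:R * overlap_thr j).
  by congr (- _); rewrite /overlap_thr [RHS]mulrC divfK // gt_eqF.
apply: le_trans (overlap_tail h_gt0 h_le hk Lam_ge0 Lam_le n_gt0 s _).
rewrite Ex_EA; apply: ler_EA => t; rewrite ExZ /= ler_wpM2l //.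
exact: Ex_wprod2 (ltnW jm).
Qed.

Lemma flat_small c : flat_overlap c -> expR (- g (size c)) <= wcount c ->
  far_mass (overlap_thr (size c)) c <= expR (- g (size c)) * wcount c ^+ 2.
Proof.
move=> fc lb; apply: le_trans fc _.
have -> : - (3 * g (size c)) = - g (size c) + (- g (size c) + - g (size c)).
  by ring.
rewrite expRD ler_wpM2l ?expR_ge0 // expRD expr2 ler_pM ?expR_ge0 //.
Qed.

Lemma wcount_step_var c : all (mem K) c -> flat_overlap c ->
  expR (- g (size c)) <= wcount c ->
  avg K (fun C => (wcount (C :: c) - wcount c) ^+ 2) <=
  (overlap_thr (size c) + expR (- g (size c))) * wcount c ^+ 2.
Proof.
move=> cK fc lb; apply: le_trans (avg_wcount2 cK) _.
apply: le_trans (@pair_average_le (fun x => x ^+ 2) (overlap_thr (size c))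
   (overlap_thr (size c)) c cK _ _ _) _ => //.
- by move=> x /andP[x1 x2]; nra.
- exact: overlap_thr_ge0.
by rewrite mulrDl lerD2l flat_small.
Qed.

(** Small mean overlap bounds the sum of squared magnetizations, hence the fraction of biased
    variables by z. All k variables of a killing clause are biased, which has probability at most
    z^k <= z^4. *)
Lemma wcount_step_kill c : (size c < m)%N -> all (mem K) c -> flat_overlap c ->
  expR (- g (size c)) <= wcount c ->
  avg K (fun C => (8 * wcount (C :: c) < wcount c)%R%:R) <= z ^+ 4.
Proof.
move=> cm cK fc lb.
have L0 : 0 < wcount c := lt_le_trans (expR_gt0 _) lb.
have L20 : 0 < wcount c ^+ 2 by rewrite exprn_gt0.
have n0 : 0 < n%:R :> R by rewrite ltr0n.
apply: (@le_trans _ _ (avg K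
   (fun C => ([set l.1 | l in C] \subset biased c)%:R))).
  apply: ler_avg => C CK; rewrite ler_nat.
  by case: ltP => // h1; rewrite kill_biased.
apply: le_trans (avg_vars_subset _) _.
have Bz : #|biased c|%:R / n%:R <= z.
  apply: le_trans (z_ge cm); rewrite ler_pdivrMr // -(ler_pM2r L20).
  have : #|biased c|%:R * wcount c ^+ 2 <= 4 * \sum_i magnetization i c ^+ 2.
    rewrite mulr_natl -sumr_const mulr_sumr.
    rewrite [leRHS](bigID (mem (biased c))) /= -[leLHS]addr0.
    apply: lerD; first by apply: ler_sum => i; rewrite inE.
    by apply: sumr_ge0 => i _; rewrite mulr_ge0 ?sqr_ge0.
  move/le_trans; apply; rewrite sum_magnetization2.
  have : EA (fun s => EA (fun t => ov s t * (wprod s c * wprod t c))) <=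
     (Num.sqrt (overlap_thr (size c)) + expR (- g (size c))) * wcount c ^+ 2.
    apply: le_trans (@pair_average_le id (overlap_thr (size c))
       (Num.sqrt (overlap_thr (size c))) c cK _ _ _) _ => //.
    - move=> x _ xt; apply: le_trans (ler_norm x) _.
      by rewrite -sqrtr_sqr ler_wsqrtr.
    - by move=> x /andP[].
    by rewrite mulrDl lerD2l flat_small.
  move/(ler_wpM2l (ltW n0)); move: (n%:R * EA _) => y hy; lra.
apply: (@le_trans _ _ (z ^+ k)).
  by rewrite lerXn2r ?nnegrE // divr_ge0.
by rewrite ler_wiXn2l.
Qed.

Lemma wcount_lower_tail :
  Ex K m (fun c => (wcount c < expR (- g m))%R%:R) <=
  m%:R * (n.+1%:R * expR (- g 0%N) + z ^+ 4 + expR (- g 0%N)).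
Proof.
apply: (@martingale_lower_tail _ _ _ _ wcount flat_overlap g
   (fun j => overlap_thr j + expR (- g j))) => //.
- by rewrite (card_kclauses R) muln_gt0 expn_gt0 bin_gt0.
- exact: wcount_nil.
- exact: wcount_ge0.
- by move=> c _; apply: wcount_martingale.
- exact: flat_tail.
- by move=> c _; apply: wcount_step_var.
- exact: wcount_step_kill.
- by rewrite exprn_ge0.
Qed.

End Bounds.

End WeightedCount.

(** * From the weighted count to the number of solutions *)

Section SolutionCount.
Variables (R : realType) (k n : nat).
Implicit Types (s t : assignment n) (C : clause n) (c : seq (clause n)).
Hypotheses (k_le_n : (k <= n)%N) (k_ge4 : (4 <= k)%N).
Hypothesis k_pow : pow_dominates R k.

Local Notation K := (kclauses k n).
Local Notation b := (bal R k).

Definition nsol c : nat := #|[set s : assignment n | all (sat_clause s) c]|.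

Definition total_balance s c : R := \sum_(C <- c) literal_balance R s C.

(** The share of L carried by assignments with atypically many false literals, whose weights
    overstate the number of solutions. *)
Definition low_balance c : R :=
  EA (fun s => (total_balance s c < - n%:R)%R%:R * wprod R k s c).

Lemma expR_le_quadratic (y : R) : y <= 2^-1 -> expR y <= 1 + y + 2 * y ^+ 2.
Proof.
move=> y1; have e : expR y <= (1 - y)^-1.
  rewrite -[leLHS]invrK -expRN lef_pV2 ?posrE ?expR_gt0 ?expR_ge1Dx //; lra.
apply: le_trans e _; have p : 0 < 1 - y by lra.
rewrite -(ler_pM2r p) mulVf ?gt_eqF //; have := sqr_ge0 y; nra.
Qed.

(** Under the weighted clause distribution H has mean zero, so only the quadratic term of the
    exponential survives. *)
Lemma avg_nweight_exp s (t : R) : 0 <= t -> t * k%:R <= 2^-1 ->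
  avg K (fun C => nweight R k s C * expR (- (t * literal_balance R s C))) <=
  expR (2 * (t * k%:R) ^+ 2).
Proof.
move=> t0 tk.
have b0 := bal_gt0 k_pow; have b1 := bal_le k_pow; have p : 0 < 1 - b by lra.
apply: (@le_trans _ _ (avg K (fun C => (1 + 2 * (t * k%:R) ^+ 2) * nweight R k s C
   + (- t / (1 - b)) * (weight b s C * literal_balance R s C)))).
  apply: ler_avg => C CK.
  have w0 := nweight_ge0 k_pow s CK.
  have := literal_balance_le R s CK; rewrite ler_norml => /andP[h1 h2].
  have e : expR (- (t * literal_balance R s C)) <=
     1 - t * literal_balance R s C + 2 * (t * k%:R) ^+ 2.
    have h3 := ler_wpM2l t0 h1; have h4 := ler_wpM2l t0 h2.
    apply: le_trans (@expR_le_quadratic _ _) _; first by lra.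
    move: h3 h4; rewrite mulrN; move: (t * literal_balance _ _ _) (t * k%:R).
    by move=> y z h3 h4; nra.
  apply: le_trans (ler_wpM2l w0 e) _.
  rewrite /nweight le_eqVlt; apply/orP; left; apply/eqP; field.
  by rewrite gt_eqF.
rewrite avgD !avgZ avg_nweight // avg_weight_balance ?bal_balanced //.
by rewrite mulr0 addr0 mulr1; apply: expR_ge1Dx.
Qed.

Lemma low_balance_ge0 c : all (mem K) c -> 0 <= low_balance c.
Proof. by move=> cK; apply: EA_ge0 => s; rewrite mulr_ge0 ?wprod_ge0. Qed.

(** With tau this rate and Chernoff parameter 2 tau, the exponent is - 2 tau n + 8 tau^2 k^2 m,
    which is at most - tau n for m <= 2^k n. *)
Definition balance_rate : R := (8 * k%:R ^+ 2 * 2 ^+ k)^-1.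

Lemma balance_rate_gt0 : 0 < balance_rate.
Proof.
by rewrite invr_gt0 !mulr_gt0 ?exprn_gt0 // ltr0n (leq_trans _ k_ge4).
Qed.

Lemma Ex_low_balance m : m%:R <= 2 ^+ k * n%:R :> R ->
  Ex K m low_balance <= expR (- (balance_rate * n%:R)).
Proof.
move=> mn; set tau := balance_rate; have tau0 : 0 < tau := balance_rate_gt0.
have k0 : 4 <= k%:R :> R by rewrite ler_nat.
have p2 : 1 <= 2 ^+ k :> R by rewrite exprn_ege1 // ler1n.
have tauE : 8 * tau * k%:R ^+ 2 * 2 ^+ k = 1.
  rewrite /tau /balance_rate; field.
  by rewrite pnatr_eq0 -lt0n (leq_trans _ k_ge4) // expf_neq0 // pnatr_eq0.
have tk : 2 * tau * k%:R <= 2^-1.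
  move: tauE p2 k0 tau0; move: (2 ^+ k) (k%:R : R) => q y.
  move=> e q1 y4 t0.
  have : 8 * tau * y ^+ 2 <= 1.
    rewrite -[leRHS]e ler_peMr // mulr_ge0 ?sqr_ge0 // mulr_ge0 //.
    exact: ltW.
  have : 0 <= tau * y * (y - 4) by rewrite mulr_ge0 ?mulr_ge0 ?(ltW t0) //; lra.
  by rewrite expr2; lra.
rewrite Ex_EA -[leRHS](@EA_cst _ n); apply: ler_EA => s.
apply: (@le_trans _ _ (Ex K m (fun c => expR (- (2 * tau * n%:R)) *
  \prod_(C <- c) (nweight R k s C *
     expR (- (2 * tau * literal_balance R s C)))))).
  apply: ler_Ex => c _ cK.
  rewrite big_split /= -/(wprod R k s c) mulrCA [leRHS]mulrC ler_wpM2r ?wprod_ge0 //.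
  have -> : \prod_(C <- c) expR (- (2 * tau * literal_balance R s C)) =
     expR (- (2 * tau * total_balance s c)).
    by rewrite -expR_sum /total_balance mulr_sumr sumrN.
  rewrite -expRD; case: ltP => [h|_]; last exact: expR_ge0.
  rewrite mulr1n -[leLHS]expR0 ler_expR -opprD -mulrDr oppr_ge0.
  by rewrite mulr_ge0_le0 ?mulr_ge0 ?(ltW tau0) //; lra.
rewrite ExZ Ex_prod.
apply: (@le_trans _ _ (expR (- (2 * tau * n%:R)) *
   expR (2 * (2 * tau * k%:R) ^+ 2) ^+ m)).
  rewrite ler_wpM2l ?expR_ge0 // lerXn2r ?nnegrE ?expR_ge0 //.
    apply: avg_ge0 => C CK; rewrite mulr_ge0 ?expR_ge0 //.
    exact: nweight_ge0.
  by apply: avg_nweight_exp => //; rewrite mulr_ge0 // ltW.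
rewrite -expRM_natl -expRD ler_expR.
have : m%:R * (2 * (2 * tau * k%:R) ^+ 2) <= tau * n%:R.
  apply: (@le_trans _ _ (2 ^+ k * n%:R * (2 * (2 * tau * k%:R) ^+ 2))).
    by rewrite ler_wpM2r // mulr_ge0 ?sqr_ge0.
  rewrite le_eqVlt; apply/orP; left; apply/eqP.
  transitivity (tau * n%:R * (8 * tau * k%:R ^+ 2 * 2 ^+ k)); first by ring.
  by rewrite tauE mulr1.
by move: (m%:R * _) => y; lra.
Qed.

(** Each factor 1 - b H is bounded by exp(- b H). *)
Lemma wprod_le s c : all (mem K) c ->
  wprod R k s c <= (all (sat_clause s) c)%:R * (1 - b) ^- size c *
               expR (- (b * total_balance s c)).
Proof.
have b0 := bal_gt0 k_pow; have b1 := bal_le k_pow; have p : 0 < 1 - b by lra.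
elim: c => [|C c IH] /=.
  by rewrite /wprod /total_balance !big_nil mulr0 oppr0 expR0 expr0 invr1 !mulr1.
move=> /andP[CK cK]; rewrite wprod_cons.
apply: le_trans (ler_wpM2l (nweight_ge0 k_pow s CK) (IH cK)) _.
rewrite /total_balance big_cons mulrDr opprD expRD exprS invfM -mulnb natrM.
rewrite -/(total_balance s c).
set A := (all _ c)%:R; set P := (1 - b) ^- size c.
set E1 := expR (- (b * literal_balance _ _ _)).
set E2 := expR _; set S := (sat_clause s C)%:R.
have -> : S * A * ((1 - b)^-1 * P) * (E1 * E2) =
   (S * E1 / (1 - b)) * (A * P * E2) by ring.
rewrite ler_wpM2r ?mulr_ge0 ?expR_ge0 ?invr_ge0 ?exprn_ge0 ?(ltW p) //.
rewrite /nweight /weight ler_pM2r ?invr_gt0 // [leLHS]mulrC ler_wpM2l //.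
exact: expR_ge1Dx.
Qed.

Lemma wcount_le_nsol c : all (mem K) c ->
  wcount R k c <= low_balance c +
    (nsol c)%:R / 2 ^+ n * ((1 - b) ^- size c * expR (b * n%:R)).
Proof.
have b0 := bal_gt0 k_pow; have b1 := bal_le k_pow; have p : 0 < 1 - b by lra.
move=> cK.
have -> : (nsol c)%:R / 2 ^+ n = EA (fun s => (all (sat_clause s) c)%:R) :> R.
  rewrite /EA /nsol -sum1_card natr_sum big_mkcond /=; congr (_ / _).
  by apply: eq_bigr => s _; rewrite inE; case: all.
rewrite mulrC -EAZ -EAD; apply: ler_EA => s.
have [h|h] := ltP (total_balance s c) (- n%:R).
  by rewrite mulr1n mul1r lerDl !mulr_ge0 ?expR_ge0 ?invr_ge0 ?exprn_ge0 ?(ltW p).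
rewrite mulr0n mul0r add0r; apply: le_trans (wprod_le s cK) _.
rewrite mulrC -mulrA mulrC; case: all; rewrite ?mulr0n ?mulr1n.
  rewrite !mul1r mulr1 ler_wpM2l ?invr_ge0 ?exprn_ge0 ?(ltW p) // ler_expR.
  by rewrite -mulrN ler_wpM2l ?(ltW b0) //; lra.
by rewrite !mul0r !mulr0.
Qed.

(** If L >= exp(- G) and at most half of that floor is low balance mass, the other half comes from
    solutions of weight at most (1 - b)^-m exp(b n), so there must be many of them. *)
Lemma nsol_lower_tail m (G : R) : m%:R <= 2 ^+ k * n%:R :> R ->
  Ex K m (fun c => ((nsol c)%:R <
     2 ^+ n * ((1 - b) ^+ m * expR (- (b * n%:R))) * (expR (- G) / 2))%R%:R) <=
  Ex K m (fun c => (wcount R k c < expR (- G))%R%:R) +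
  2 * expR (G - balance_rate * n%:R).
Proof.
have b0 := bal_gt0 k_pow; have b1 := bal_le k_pow; have p : 0 < 1 - b by lra.
move=> mn.
have e2 : 0 < expR (- G) / 2 by rewrite divr_gt0 ?expR_gt0.
have K0 : (0 < #|K|)%N by rewrite (card_kclauses R) muln_gt0 expn_gt0 bin_gt0.
have T : Ex K m (fun c => (expR (- G) / 2 < low_balance c)%R%:R) <=
   2 * expR (G - balance_rate * n%:R).
  apply: le_trans (@Ex_markov _ _ _ _ _ _ e2 _) _.
    by move=> c _; apply: low_balance_ge0.
  rewrite ler_pdivrMr // expRD.
  have -> : 2 * (expR G * expR (- (balance_rate * n%:R))) * (expR (- G) / 2) =
    expR (- (balance_rate * n%:R)) * (expR G * expR (- G)) by field.
  by rewrite -expRD subrr expR0 mulr1 Ex_low_balance.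
apply: le_trans (lerD (lexx _) T); rewrite -ExD; apply: ler_Ex => c cm cK.
have [h1|h1] := ltP (wcount R k c) (expR (- G)).
  by rewrite mulr1n -[leLHS]addr0 lerD // lern1 leq_b1.
have [h2|h2] := ltP (expR (- G) / 2) (low_balance c).
  by rewrite mulr0n mulr1n add0r lern1 leq_b1.
rewrite !mulr0n addr0 lern0 eqb0 -leNgt.
have := wcount_le_nsol cK; rewrite cm => h3.
have {h1 h2 h3} : expR (- G) / 2 <= (nsol c)%:R / 2 ^+ n *
  ((1 - b) ^- m * expR (b * n%:R)) by lra.
pose X := (1 - b) ^+ m * expR (- (b * n%:R)); rewrite -/X.
have X0 : 0 < X by rewrite mulr_gt0 ?expR_gt0 ?exprn_gt0.
have -> : (1 - b) ^- m * expR (b * n%:R) = X^-1.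
  by rewrite /X invfM -expRN opprK.
rewrite ler_pdivlMr // ler_pdivlMr ?exprn_gt0 // => h.
by rewrite [leLHS]mulrC [2 ^+ n * X]mulrC mulrA.
Qed.

End SolutionCount.

(** * Transfer to random formulas without repeated clauses *)

(** Birthday bound: the proportion of sequences of length m without repetition is at least 1 - m^2 /
    N. *)
Lemma ffact_lower (R : realType) (N m : nat) : (0 < N)%N -> (m <= N)%N ->
  (1 - m%:R ^+ 2 / N%:R) * N%:R ^+ m <= (N ^_ m)%:R :> R.
Proof.
move=> N0; have N0' : 0 < N%:R :> R by rewrite ltr0n.
elim: m => [|m IH] mN; first by rewrite expr0 ffactn0 mulr1 expr0n mul0r subr0.
rewrite ffactnSr natrM natrB ?(ltnW mN) // [N%:R ^+ _]exprSr mulrA.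
have NE : N%:R - m%:R = (1 - m%:R / N%:R) * N%:R :> R.
  by field; rewrite gt_eqF.
rewrite NE mulrA ler_pM2r //.
have mN' : m%:R / N%:R <= 1 :> R.
  by rewrite ler_pdivrMr // mul1r ler_nat ltnW.
have q0 : 0 <= 1 - m%:R / N%:R :> R by lra.
apply: le_trans (ler_wpM2r q0 (IH (ltnW mN))).
rewrite [leRHS]mulrAC ler_wpM2r ?exprn_ge0 ?ler0n // -[m.+1%:R]natr1.
have a0 : 0 <= m%:R / N%:R :> R by rewrite divr_ge0.
have b0 : 0 <= m%:R ^+ 2 / N%:R :> R by rewrite divr_ge0 ?sqr_ge0.
have -> : (m%:R + 1) ^+ 2 / N%:R = m%:R ^+ 2 / N%:R + 2 * (m%:R / N%:R) + N%:R^-1 :> R.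
  by field; rewrite gt_eqF.
have c0 : 0 <= N%:R^-1 :> R by rewrite invr_ge0 ltW.
by have := mulr_ge0 a0 b0; lra.
Qed.

Section Transfer.
Variables (R : realType) (k n : nat).
Implicit Types (F : formula n) (C : clause n) (s : assignment n).

Local Notation K := (kclauses k n).

(** Every formula is the set of exactly m! sequences without repetition, and the remaining sequences
    only enlarge the right side. *)
Lemma kcnf_sum_Ex (m : nat) (phi : formula n -> R) : (forall F, 0 <= phi F) ->
  (m`!)%:R * (\sum_(F in kcnf k n m) phi F) <=
  #|K|%:R ^+ m * Ex K m (fun c => phi [set C in c]%SET).
Proof.
elim: m phi => [|m IH] phi phi0.
  rewrite fact0 expr0 !mul1r /= (eq_bigl (pred1 finset.set0)); last first.
    move=> F; rewrite !inE cards_eq0; case: eqP => [->|_].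
      by rewrite finset.sub0set.
    by rewrite andbF.
  rewrite big_pred1_eq; suff -> : [set C in [::]]%SET = finset.set0 :> formula n by [].
  by apply/setP => C; rewrite !inE.
pose psi F : R := \sum_(C in K) phi (C |: F).
have -> : #|K|%:R ^+ m.+1 * Ex K m.+1 (fun c => phi [set C in c]%SET) =
   #|K|%:R ^+ m * Ex K m (fun c => psi [set C in c]%SET).
  rewrite exprSr -mulrA [Ex K m.+1 _]/= -ExZ; congr (_ * _).
  apply: eq_Ex => c _ _.
  rewrite /avg /psi.
  have -> : \sum_(C in K) phi [set C0 in C :: c]%SET =
     \sum_(C in K) phi (C |: [set C0 in c]%SET).
    by apply: eq_bigr => C _; congr phi; apply/setP => C'; rewrite !inE.
  have [K0|K0] := posnP #|K|.
    rewrite K0 mul0r big_pred0 // => C; apply/negbTE/negP => CK.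
    by have := card0_eq K0 C; rewrite CK.
  by rewrite mulrC divfK // pnatr_eq0 -lt0n.
apply: le_trans (IH psi _); last by move=> F; apply: sumr_ge0.
rewrite factS natrM mulrAC mulrC ler_wpM2l //.
apply: (@le_trans _ _ (\sum_(F in kcnf k n m) \sum_(C in K | C \notin F)
    phi (C |: F))); last first.
  apply: ler_sum => F _; rewrite /psi [leRHS](bigID (fun C => C \in F)) /=.
  by rewrite lerDr; apply: sumr_ge0.
rewrite (exchange_big_dep (fun C => C \in K)) /=; last by move=> F C _ /andP[].
(* Double count of pairs of a formula and one of its m + 1 clauses. *)
have -> : m.+1%:R * (\sum_(F in kcnf k n m.+1) phi F) =
  \sum_(C in K) \sum_(F in kcnf k n m.+1 | C \in F) phi F.
  rewrite (exchange_big_dep (fun F => F \in kcnf k n m.+1)) /=; last first.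
    by move=> C F _ /andP[].
  rewrite mulr_sumr; apply: eq_bigr => F FK.
  have /andP[/fintype.subsetP sF /eqP cF] : (F \subset K) && (#|F| == m.+1).
    by move: FK; rewrite inE.
  rewrite -[X in X%:R * _]cF mulr_natl -sumr_const; apply: eq_bigl => C.
  rewrite FK /=; case CF : (C \in F); rewrite ?andbF // andbT.
  by rewrite sF.
apply: ler_sum => C CK.
(* Adding C is a bijection from the m-clause formulas without C onto the (m + 1)-clause formulas
   with C. *)
rewrite (reindex_onto (fun F => C |: F) (fun F => F :\ C)) /=; last first.
  by move=> F /andP[_ CF]; rewrite finset.setD1K.
rewrite le_eqVlt; apply/orP; left; apply/eqP; apply: eq_bigl => F.
rewrite CK !inE eqxx andbT /= finset.subUset finset.sub1set CK /=.
case CF : (C \in F) => /=.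
  rewrite andbF; apply/negbTE/negP => /andP[_ /eqP e].
  by move: CF; rewrite -e !inE eqxx.
rewrite cardsU1 CF /= add1n eqSS finset.setU1K ?CF // eqxx !andbT.
by [].
Qed.

Lemma card_kcnf m : #|kcnf k n m| = 'C(#|K|, m).
Proof. by rewrite -cards_draws; apply: eq_card => F; rewrite !inE. Qed.

Lemma Pr_random_kcnfE m (A : {set formula n}) :
  Pr (random_kcnf k R m) A =
  (\sum_(F in kcnf k n m) (F \in A)%:R) / #|kcnf k n m|%:R.
Proof.
rewrite /Pr /random_kcnf /unif -mulr_suml; congr (_ / _).
rewrite [LHS]big_mkcond [RHS]big_mkcond; apply: eq_bigr => F _.
by case: (F \in A); case: (F \in kcnf _ _ _).
Qed.

(** When 2 m^2 <= |K|, at least half of all sequences have no repetition, whence the factor 2. *)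
Lemma Pr_random_kcnf_le m (A : {set formula n}) : (0 < #|K|)%N ->
  (m <= #|K|)%N -> 2 * m%:R ^+ 2 <= #|K|%:R :> R ->
  Pr (random_kcnf k R m) A <= 2 * Ex K m (fun c => ([set C in c]%SET \in A)%:R).
Proof.
move=> K0 mK m2; rewrite Pr_random_kcnfE.
have K0' : 0 < #|K|%:R :> R by rewrite ltr0n.
have kc0 : 0 < #|kcnf k n m|%:R :> R by rewrite ltr0n card_kcnf bin_gt0.
rewrite ler_pdivrMr //.
have f0 : 0 < (m`!)%:R :> R by rewrite ltr0n fact_gt0.
rewrite -(ler_pM2l f0).
apply: le_trans (@kcnf_sum_Ex m (fun F => (F \in A)%:R) _) _ => //.
set X := Ex _ _ _.
have X0 : 0 <= X by apply: Ex_ge0.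
have -> : (m`!)%:R * (2 * X * #|kcnf k n m|%:R) =
   2 * (#|K| ^_ m)%:R * X.
  by rewrite card_kcnf -bin_ffact natrM; ring.
rewrite ler_wpM2r //.
have := ffact_lower R K0 mK; set P := _ ^+ m => h.
have P0 : 0 <= P by rewrite exprn_ge0.
have q : 2^-1 <= 1 - m%:R ^+ 2 / #|K|%:R :> R.
  have : m%:R ^+ 2 / #|K|%:R <= 2^-1 :> R by rewrite ler_pdivrMr //; lra.
  lra.
have := ler_wpM2r P0 q; lra.
Qed.

Lemma satisfies_seq s (c : seq (clause n)) :
  satisfies s [set C in c]%SET = all (sat_clause s) c.
Proof.
apply/forall_inP/allP => h C.
  by move=> Cc; apply: h; rewrite inE.
by rewrite inE; apply: h.
Qed.

Lemma card_solutions_seq (c : seq (clause n)) :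
  #|solutions [set C in c]%SET| = nsol c.
Proof. by apply: eq_card => s; rewrite !inE satisfies_seq. Qed.

Hypothesis k_le_n : (k <= n)%N.

Lemma card_sat_clauses s :
  #|[set C in K | sat_clause s C]|%:R = (1 - 2 ^- k) * #|K|%:R :> R.
Proof.
have K0 : (0 < #|K|)%N by rewrite (card_kclauses R) muln_gt0 expn_gt0 bin_gt0.
have K0' : #|K|%:R != 0 :> R by rewrite pnatr_eq0 -lt0n.
rewrite -(avg_violated R k_le_n s) -[X in X - _](avg_cst K0 1).
rewrite -mulN1r -avgZ -avgD /avg divfK // -sum1_card natr_sum.
rewrite [LHS]big_mkcond [RHS]big_mkcond; apply: eq_bigr => C _.
rewrite [C \in [set _ in _ | _]]inE /violated; case: (C \in K) => //=.
by case: sat_clause; rewrite /= ?mulr0n ?mulr1n ?mulr0 ?addr0 // mulr1 subrr.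
Qed.

Lemma card_kcnf_sat m s :
  #|[set F in kcnf k n m | satisfies s F]| =
  'C(#|[set C in K | sat_clause s C]|, m).
Proof.
rewrite -cards_draws; apply: eq_card => F; rewrite !inE -andbA andbCA [RHS]andbC.
congr (_ && _).
apply/andP/fintype.subsetP => [[/fintype.subsetP h1 /forall_inP h2] C CF|h].
  by rewrite inE h1 ?h2.
split; first by apply/fintype.subsetP => C /h; rewrite inE => /andP[].
by apply/forall_inP => C /h; rewrite inE => /andP[].
Qed.

(** The planted probability of a satisfied pair is 2^-n / C(|S|, m), where S holds the (1 - 2^-k)
    |K| clauses true under s. The factor bounds the mean number of solutions from above. *)
Lemma random_le_planted m F s : (m <= #|K|)%N -> satisfies s F ->
  random_kcnf k R m F <= 2 ^+ n * (1 - 2 ^- k) ^+ m * planted_model k R m (F, s).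
Proof.
move=> mK sF.
have K0 : (0 < #|K|)%N by rewrite (card_kclauses R) muln_gt0 expn_gt0 bin_gt0.
have K0' : #|K|%:R != 0 :> R by rewrite pnatr_eq0 -lt0n.
have [FK|FK] := boolP (F \in kcnf k n m); last first.
  rewrite /random_kcnf /unif (negbTE FK) mulr0n mul0r.
  rewrite mulr_ge0 ?mulr_ge0 ?exprn_ge0 ?invr_ge0 //.
  by rewrite subr_ge0 invf_le1 ?exprn_gt0 // exprn_ege1 // ler1n.
have -> : planted_model k R m (F, s) =
   (2 ^+ n)^-1 * 'C(#|[set C in K | sat_clause s C]|, m)%:R^-1.
  rewrite /planted_model /unif /= finset.in_setT.
  have -> : F \in [set F in kcnf k n m | satisfies s F] by rewrite inE FK.
  by rewrite cardsT card_assignment card_kcnf_sat natrX !mul1r.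
rewrite /random_kcnf /unif FK mul1r card_kcnf.
set S := [set C in K | sat_clause s C].
have SK : (#|S| <= #|K|)%N.
  by apply: subset_leq_card; apply/fintype.subsetP => C; rewrite inE => /andP[].
have := bin_ratioR R SK mK K0.
have -> : #|S|%:R / #|K|%:R = 1 - 2 ^- k :> R by rewrite card_sat_clauses mulfK.
have S0 : 0 < 'C(#|S|, m)%:R :> R.
  rewrite ltr0n -card_kcnf_sat card_gt0; apply/finset.set0Pn; exists F.
  by rewrite inE FK.
have p2 : 2 ^+ n != 0 :> R by rewrite expf_neq0.
move=> h; have -> : 2 ^+ n * (1 - 2 ^- k) ^+ m * ((2 ^+ n)^-1 * 'C(#|S|, m)%:R^-1)
  = (1 - 2 ^- k) ^+ m / 'C(#|S|, m)%:R :> R.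
  by move: ((1 - _) ^+ m) => y; field; rewrite gt_eqF // p2.
by rewrite ler_pdivlMr // mulrC.
Qed.

Lemma Pr_pair (mu : formula n * assignment n -> R)
    (A : {set formula n * assignment n}) :
  Pr mu A = \sum_F \sum_s ((F, s) \in A)%:R * mu (F, s).
Proof.
rewrite /Pr big_mkcond pair_bigA /=; apply: eq_bigr => -[F s] _ /=.
by case: (_ \in A); rewrite ?mulr1n ?mulr0n ?mul1r ?mul0r.
Qed.

Lemma Pr_set (T : finType) (mu : T -> R) (A : {set T}) :
  Pr mu A = \sum_x (x \in A)%:R * mu x.
Proof.
rewrite /Pr big_mkcond; apply: eq_bigr => x _.
by case: (_ \in A); rewrite ?mulr1n ?mulr0n ?mul1r ?mul0r.
Qed.

(** Formula by formula: if F is in D with at least z0 solutions, the fraction of solutions outside E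
    is at most their number over z0, and [random_le_planted] converts that number into planted mass.
    All other formulas are given up. *)
Lemma uniform_model_lower m (D : {set formula n})
    (E : {set formula n * assignment n}) (z0 : R) :
  (m <= #|K|)%N -> 0 < z0 ->
  Pr (random_kcnf k R m) D
  - Pr (random_kcnf k R m) [set F : formula n | #|solutions F|%:R < z0]
  - 2 ^+ n * (1 - 2 ^- k) ^+ m / z0 *
    Pr (planted_model k R m) ([set p | p.1 \in D] :\: E)
  <= Pr (uniform_model k R m) E.
Proof.
move=> mK z00; set c := 2 ^+ n * (1 - 2 ^- k) ^+ m.
rewrite [Pr (planted_model _ _ _) _]Pr_pair [Pr (uniform_model _ _ _) _]Pr_pair.
rewrite !Pr_set mulr_sumr -!sumrN -!big_split /=.
apply: ler_sum => F _; set rF := random_kcnf k R m F.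
have rF0 : 0 <= rF by rewrite divr_ge0.
have c0 : 0 <= c.
  rewrite mulr_ge0 ?exprn_ge0 // subr_ge0 invf_le1 ?exprn_gt0 //.
  by rewrite exprn_ege1 // ler1n.
have pl0 s : 0 <= planted_model k R m (F, s).
  by rewrite mulr_ge0 ?divr_ge0.
have U0 : 0 <= \sum_s ((F, s) \in E)%:R * uniform_model k R m (F, s).
  by apply: sumr_ge0 => s _; rewrite mulr_ge0 // mulr_ge0 ?divr_ge0.
set P := \sum_s _ * planted_model _ _ _ _.
have P0 : 0 <= c / z0 * P.
  rewrite mulr_ge0 ?divr_ge0 ?(ltW z00) //; apply: sumr_ge0 => s _.
  by rewrite mulr_ge0.
rewrite [F \in [set _ | _]]inE.
have [FD|FD] := boolP (F \in D); last first.
  rewrite mulr0n mul0r add0r; apply: le_trans U0; rewrite -opprD oppr_le0.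
  by rewrite addr_ge0 // mulr_ge0.
have [Zz|Zz] := ltP #|solutions F|%:R z0.
  by rewrite !mulr1n mul1r subrr add0r (le_trans _ U0) // oppr_le0.
rewrite mulr1n mulr0n mul1r mul0r subr0.
(* The number of solutions of F outside E. *)
pose beta : R := \sum_s ((F, s) \notin E)%:R * (satisfies s F)%:R.
have Z0 : 0 < #|solutions F|%:R :> R := lt_le_trans z00 Zz.
have b0 : 0 <= beta by apply: sumr_ge0 => s _; rewrite mulr_ge0.
have hP : rF * beta <= c * P.
  rewrite !mulr_sumr; apply: ler_sum => s _.
  rewrite !inE /= FD andbT; case: ((F, s) \in E) => /=.
    by rewrite !mulr0n !mul0r !mulr0.
  rewrite mulr1n !mul1r; case sF : (satisfies s F) => /=; last first.
    by rewrite mulr0n mulr0 mulr_ge0.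
  by rewrite mulr1n mulr1 random_le_planted.
have -> : \sum_s ((F, s) \in E)%:R * uniform_model k R m (F, s) =
   rF * (1 - beta / #|solutions F|%:R).
  have e1 : \sum_s (satisfies s F)%:R = #|solutions F|%:R :> R.
    rewrite -sum1_card natr_sum [RHS]big_mkcond; apply: eq_bigr => s _.
    by rewrite inE; case: satisfies.
  have -> : 1 - beta / #|solutions F|%:R =
      (\sum_s (satisfies s F)%:R - beta) / #|solutions F|%:R.
    by rewrite mulrBl e1 mulfV ?lt0r_neq0.
  rewrite mulrA -sumrB mulr_sumr mulr_suml; apply: eq_bigr => s _.
  rewrite /uniform_model /unif /= inE -/rF.
  by case: (_ \in E); case: satisfies; rewrite /= ?mulr0n ?mulr1n; ring.
apply: (@le_trans _ _ (rF * (1 - beta / z0))).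
  rewrite mulrBr mulr1 lerD2l lerN2 [leLHS]mulrA [leRHS]mulrAC.
  by rewrite ler_pM2r ?invr_gt0.
by rewrite ler_wpM2l // lerD2l lerN2 ler_wpM2l // lef_pV2 ?posrE.
Qed.

End Transfer.

(** * Asymptotics *)

Local Open Scope classical_set_scope.

Section Asymptotics.
Variable R : realType.

(** Used twice: at k as the h of the overlap rate, at n as the scale of the error terms. *)
Definition isqrt (n : nat) : R := (Num.sqrt n.+1%:R)^-1.

Lemma isqrt_gt0 n : 0 < isqrt n.
Proof. by rewrite invr_gt0 sqrtr_gt0 ltr0n. Qed.

Lemma isqrt2 n : isqrt n ^+ 2 * n.+1%:R = 1.
Proof. by rewrite exprVn sqr_sqrtr ?ler0n // mulVf. Qed.

Lemma isqrt_le1 n : isqrt n <= 1.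
Proof.
rewrite invf_le1 ?sqrtr_gt0 ?ltr0n // -{1}(@sqrtr1 R) ler_wsqrtr //.
by rewrite ler1n.
Qed.

Lemma inv_le_isqrt n : (0 < n)%N -> n%:R^-1 <= 2 * isqrt n.
Proof.
move=> n0; have n0' : 0 < n%:R :> R by rewrite ltr0n.
have := isqrt2 n; have := isqrt_le1 n; have := isqrt_gt0 n.
rewrite -[n.+1%:R]natr1; move: (isqrt n) => h h0 h1 e.
have n1 : 1 <= n%:R :> R by rewrite ler1n.
have e1 : n%:R^-1 <= 2 * h ^+ 2.
  by rewrite -(ler_pM2r n0') mulVf ?gt_eqF //; nra.
by apply: le_trans e1 _; nra.
Qed.

Lemma isqrt_small (d : R) : 0 < d -> \forall n \near \oo, isqrt n <= d.
Proof.
move=> d0; near=> n.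
rewrite /isqrt -[leRHS]invrK lef_pV2 ?posrE ?sqrtr_gt0 ?ltr0n ?invr_gt0 //.
rewrite -[leLHS]ger0_norm ?invr_ge0 ?(ltW d0) // -sqrtr_sqr ler_wsqrtr //.
apply: (@le_trans _ _ n%:R); last by rewrite ler_nat.
by near: n; apply: nbhs_infty_ger.
Unshelve. all: by end_near. Qed.

Lemma isqrt_cvg : (isqrt @ \oo --> (0 : R)).
Proof.
apply/cvgrPdist_le => d d0; near=> n.
rewrite sub0r normrN gtr0_norm ?isqrt_gt0 //.
by near: n; apply: isqrt_small.
Unshelve. all: by end_near. Qed.

(** With y the fourth root of n + 1, the logarithm is 4 ln y <= 4 y. *)
Lemma ln_le_isqrt n : (0 < n)%N -> ln n.+1%:R ^+ 2 <= 32 * isqrt n * n%:R.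
Proof.
move=> n0; have n1 : 1 <= n%:R :> R by rewrite ler1n.
pose y : R := Num.sqrt (Num.sqrt n.+1%:R).
have y0 : 0 < y by rewrite !sqrtr_gt0 ltr0n.
have y4 : n.+1%:R = y ^+ 4.
  by rewrite (exprM y 2 2) !sqr_sqrtr ?sqrtr_ge0.
have hE : isqrt n = (y ^+ 2)^-1 by rewrite /isqrt sqr_sqrtr ?sqrtr_ge0.
have l0 : 0 <= ln n.+1%:R :> R by rewrite ln_ge0 // ler1n.
have l1 : ln n.+1%:R <= 4 * y.
  rewrite y4 lnXn // -[_ *+ 4]mulr_natl ler_pM2l //.
  rewrite -ler_expR lnK ?posrE //; have := expR_ge1Dx y; lra.
have e : isqrt n * y ^+ 2 = 1 by rewrite hE mulVf // gt_eqF // exprn_gt0.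
have n2 : y ^+ 4 <= 2 * n%:R by rewrite -y4 -natr1; lra.
apply: (@le_trans _ _ (16 * y ^+ 2)).
  by rewrite expr2; have := ler_pM l0 l0 l1 l1; lra.
have -> : 16 * y ^+ 2 = 16 * isqrt n * y ^+ 4.
  by rewrite (exprD y 2 2) -[LHS]mulr1 -e; ring.
have := isqrt_gt0 n; move: (isqrt n) => h h0.
by have := ler_wpM2l (ltW h0) n2; lra.
Qed.

Lemma square_le_pow k : (12 <= k)%N -> 16 * k.+1%:R ^+ 2 <= 2 ^+ k :> R.
Proof.
move=> /subnKC <-; elim: (k - 12)%N => [|j IH].
  by rewrite addn0 -!natrX -natrM ler_nat.
rewrite addnS [2 ^+ _.+1]exprS -[(12 + j).+2%:R]natr1.
have y : 13 <= (12 + j).+1%:R :> R by rewrite ler_nat.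
by move: y IH; move: ((12 + j).+1%:R : R) (2 ^+ (12 + j)) => y q; nra.
Qed.

Section Threshold.
Variable k : nat.
Local Notation h := (isqrt k).
Hypothesis eps_lt1 : 100 * h < 1.

Lemma large_k : (12 <= k)%N.
Proof.
have h0 := isqrt_gt0 k; have := isqrt2 k.
have e1 := eps_lt1; have h1 : h <= 100^-1 by lra.
have : h ^+ 2 <= 13^-1.
  by have := ler_pM (ltW h0) (ltW h0) h1 h1; rewrite expr2; lra.
move/(ler_wpM2r (ler0n R k.+1)) => h2 e; rewrite e in h2.
by rewrite -ltnS -(ler_nat R); lra.
Qed.

Lemma large_pow : pow_dominates R k.
Proof.
apply: le_trans (square_le_pow large_k); rewrite ler_pM2l // ler_peMr //.
by rewrite ler1n.
Qed.

Definition rho : R := (1 - 100 * h) * 2 ^+ k * ln 2.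

Lemma rho_bounds : 0 <= rho <= 2 ^+ k.
Proof.
have /andP[l1 l2] := ln2_bounds R; have h0 := isqrt_gt0 k; have e1 := eps_lt1.
have p : 0 < 2 ^+ k :> R by rewrite exprn_gt0.
rewrite /rho mulrAC mulr_ge0 ?(ltW p) ?mulr_ge0 //=; [|lra|lra].
rewrite ler_piMl ?(ltW p) //; apply: mulr_ile1; lra.
Qed.

(** Replacing [norm_bal] by 2^-k costs a factor at most (1 + h)^2 <= 1 + 3 h. Since (1 - 100 h)(1 +
    3 h) <= 1 - 97 h and ln 2 >= 1/2, the slack 22 h remains. *)
Lemma threshold_rate : rho * norm_bal R k ^+ 2 * 2 ^+ k <= ln 2 - 22 * h.
Proof.
have /andP[l1 l2] := ln2_bounds R; have h0 := isqrt_gt0 k; have e1 := eps_lt1.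
have X : 0 <= norm_bal R k * 2 ^+ k <= 1 + h.
  rewrite (norm_balE large_pow).
  have q := square_le_pow large_k; have e := isqrt2 k.
  have k13 : 13 <= k.+1%:R :> R by rewrite ler_nat; apply: large_k.
  have -> : 2 ^+ k - k%:R - 1 = 2 ^+ k - k.+1%:R :> R.
    by rewrite -[k.+1%:R]natr1; ring.
  move: q e k13; move: (2 ^+ k) (k.+1%:R : R) => q y q1 e y1.
  have p : 0 < q - y by nra.
  have q0 : 0 <= q by nra.
  apply/andP; split; first by rewrite mulr_ge0 // invr_ge0 ltW.
  rewrite mulrC ler_pdivrMr //.
  (* As h^2 (k + 1) = 1, this is 1 / h >= 100; with 16 (k + 1)^2 <= 2^k it yields 1600 (k + 1) <= h
     2^k. *)
  have hy : 100 <= h * y.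
    rewrite -(ler_pM2l h0); nra.
  have : 16 * y * 100 <= 16 * y * (h * y) by rewrite ler_wpM2l //; lra.
  have := ler_wpM2l (ltW h0) q1.
  nra.
have -> : rho * norm_bal R k ^+ 2 * 2 ^+ k =
   (1 - 100 * h) * (norm_bal R k * 2 ^+ k) ^+ 2 * ln 2.
  by rewrite /rho; move: (norm_bal R k) (2 ^+ k) => x q; ring.
move: X; move: (_ * 2 ^+ k) => X /andP[X0 X1].
have X2 : X ^+ 2 <= 1 + 3 * h by nra.
have e : (1 - 100 * h) * X ^+ 2 <= 1 - 97 * h.
  apply: (@le_trans _ _ ((1 - 100 * h) * (1 + 3 * h))).
    by rewrite ler_wpM2l //; lra.
  nra.
have l0 : 0 <= ln 2 :> R by lra.
by have := ler_wpM2r l0 e; nra.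
Qed.

End Threshold.

End Asymptotics.

(** * The schedule of floors and the typical number of solutions *)

Section Typical.
Variables (R : realType) (k : nat).
Hypothesis eps_lt1 : 100 * isqrt R k < 1.

(** The step condition asks for 8 (4 (k + 1) g / n + exp(- g)), and exp(- g) <= g / n. Then
    [schedule_cst] bounds the schedule over ln (n + 1) during 2^k n steps. *)
Definition schedule_rate : R := 32 * k.+1%:R + 8.
Definition schedule_cst : R := 3 * expR (schedule_rate * 2 ^+ k).
Definition zbound_cst : R := 32 * (4 * schedule_cst * k.+1%:R + 1).

(* Solves g(j+1) - g(j) = schedule_rate g(j) / n, the growth that the variance
   of a step forces on the exponent of the lower bound. *)
Definition schedule (n j : nat) : R :=
  3 * ln n.+1%:R * (1 + schedule_rate / n%:R) ^+ j.

Let schedule_rate_ge0 : 0 <= schedule_rate.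
Proof. by rewrite addr_ge0 // mulr_ge0. Qed.

Let schedule_cst_ge0 : 0 <= schedule_cst.
Proof. by rewrite mulr_ge0 // expR_ge0. Qed.

Let zbound_cst_ge0 : 0 <= zbound_cst.
Proof. by rewrite mulr_ge0 // addr_ge0 // !mulr_ge0. Qed.

Section FixedSize.
Variables (n m : nat).
Hypothesis n_ge2 : (2 <= n)%N.
Hypothesis m_le : m%:R <= 2 ^+ k * n%:R :> R.

Let n_gt0 : 0 < n%:R :> R.
Proof. by rewrite ltr0n ltnW. Qed.

Lemma ln_half : 2^-1 <= ln n.+1%:R :> R.
Proof.
have /andP[l1 _] := ln2_bounds R; apply: le_trans l1 _.
by rewrite ler_ln ?posrE // ler_nat ltnW.
Qed.

Lemma ln_le_size : ln n.+1%:R <= 64 * isqrt R n * n%:R.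
Proof.
have l1 := ln_half; have := @ln_le_isqrt R n (ltnW n_ge2).
by move: (ln _) l1 => l l1; nra.
Qed.

Lemma schedule_ge j : 3 * ln n.+1%:R <= schedule n j.
Proof.
have l := ln_half; rewrite ler_peMr ?mulr_ge0 //; first by lra.
by rewrite exprn_ege1 // lerDl divr_ge0.
Qed.

Lemma schedule_le j : (j <= m)%N -> schedule n j <= schedule_cst * ln n.+1%:R.
Proof.
move=> jm; have l := ln_half.
rewrite /schedule /schedule_cst mulrAC ler_wpM2r //; first by lra.
rewrite ler_pM2l //.
apply: (@le_trans _ _ (expR (schedule_rate / n%:R) ^+ j)).
  rewrite lerXn2r ?nnegrE ?expR_ge0 ?addr_ge0 ?divr_ge0 //.
  exact: expR_ge1Dx.
rewrite -expRM_natl ler_expR mulrCA ler_wpM2l // ler_pdivrMr //.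
by apply: le_trans m_le; rewrite ler_nat.
Qed.

(** The cube survives the loss of a factor n + 1 in the overlap tail and of O(n) in the union over
    steps. *)
Lemma expR_schedule0 : expR (- schedule n 0) = n.+1%:R ^- 3.
Proof.
rewrite /schedule expr0 mulr1 -mulrN -[3](mulr1n 3) mulr1n expRM_natl.
by rewrite expRN lnK ?posrE // exprVn.
Qed.

Lemma expR_schedule_le j : expR (- schedule n j) <= n%:R^-1.
Proof.
apply: (@le_trans _ _ (expR (- schedule n 0))).
  rewrite ler_expR lerN2; apply: le_trans (schedule_ge j).
  by rewrite /schedule expr0 mulr1.
rewrite expR_schedule0 lef_pV2 ?posrE ?exprn_gt0 //.
apply: (@le_trans _ _ n.+1%:R); first by rewrite ler_nat.
by rewrite -[leLHS]expr1 ler_weXn2l // ler1n.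
Qed.

Lemma overlap_thr_schedule j :
  overlap_thr n (isqrt R k) (schedule n) j = 4 * k.+1%:R * schedule n j / n%:R.
Proof.
have e := isqrt2 R k; have h0 := isqrt_gt0 R k.
rewrite /overlap_thr; have -> : k.+1%:R = (isqrt R k ^+ 2)^-1.
  by rewrite -[LHS](mulKf (lt0r_neq0 (exprn_gt0 2 h0))) e mulr1.
by field; rewrite !gt_eqF.
Qed.

Lemma schedule_step j :
  8 * (overlap_thr n (isqrt R k) (schedule n) j + expR (- schedule n j)) <=
  schedule n j.+1 - schedule n j.
Proof.
have -> : schedule n j.+1 - schedule n j = schedule n j * (schedule_rate / n%:R).
  by rewrite /schedule exprSr; ring.
have g1 : 1 <= schedule n j.
  by apply: le_trans (schedule_ge j); have := ln_half; lra.
have e : expR (- schedule n j) <= schedule n j / n%:R.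
  apply: le_trans (expR_schedule_le j) _.
  by rewrite ler_peMl // invr_ge0 ltW.
rewrite overlap_thr_schedule /schedule_rate; move: e g1 (ltW n_gt0).
move: (k.+1%:R : R) (schedule n j) (expR (- schedule n j)) => z y x.
have -> : y * ((32 * z + 8) / n%:R) = 8 * (4 * z * y / n%:R + y / n%:R) by ring.
by move=> h _ _; rewrite ler_pM2l // lerD2l.
Qed.

Definition zbound : R := Num.sqrt (zbound_cst * ln n.+1%:R / n%:R).

Lemma zbound_ge j : (j <= m)%N ->
  4 * (Num.sqrt (overlap_thr n (isqrt R k) (schedule n) j) + expR (- schedule n j))
  <= zbound.
Proof.
move=> jm; have l := ln_half; have sl := schedule_le jm.
have t0 : 0 <= overlap_thr n (isqrt R k) (schedule n) j.
  have s0 : 0 <= schedule n j by apply: le_trans (schedule_ge j); lra.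
  rewrite overlap_thr_schedule; move: (schedule n j) s0 => y y0.
  by rewrite divr_ge0 ?(ltW n_gt0) // !mulr_ge0.
have t1 : overlap_thr n (isqrt R k) (schedule n) j <=
   4 * schedule_cst * k.+1%:R * ln n.+1%:R / n%:R.
  rewrite overlap_thr_schedule ler_pM2r ?invr_gt0 //.
  have -> : 4 * schedule_cst * k.+1%:R * ln n.+1%:R =
      4 * k.+1%:R * (schedule_cst * ln n.+1%:R).
    by ring.
  by rewrite ler_wpM2l // mulr_ge0.
have := expR_schedule_le j; have := expR_ge0 (- schedule n j).
move: (expR _) => y y0 y1.
set x := Num.sqrt _; have x0 : 0 <= x := sqrtr_ge0 _.
have x2 : x ^+ 2 = overlap_thr n (isqrt R k) (schedule n) j by rewrite sqr_sqrtr.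
rewrite -[leLHS]ger0_norm ?mulr_ge0 ?addr_ge0 // -sqrtr_sqr ler_wsqrtr //.
have y2 : y ^+ 2 <= ln n.+1%:R / n%:R.
  apply: (@le_trans _ _ (n%:R^-1 * n%:R^-1)).
    by rewrite expr2 ler_pM.
  rewrite ler_pM2r ?invr_gt0 //; apply: le_trans l.
  by rewrite lef_pV2 ?posrE // ler_nat.
(* 16 (x + y)^2 <= 32 (x^2 + y^2), the origin of the 32 in [zbound_cst]. *)
apply: (@le_trans _ _ (32 * (x ^+ 2 + y ^+ 2))).
  by have := sqr_ge0 (x - y); nra.
rewrite x2 /zbound_cst.
have -> : 32 * (4 * schedule_cst * k.+1%:R + 1) * ln n.+1%:R / n%:R =
  32 * (4 * schedule_cst * k.+1%:R * ln n.+1%:R / n%:R + ln n.+1%:R / n%:R) by ring.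
by rewrite ler_pM2l // lerD.
Qed.

Hypothesis k_le_n : (k <= n)%N.
Hypothesis m_rho : m%:R <= rho R k * n%:R.
Hypothesis n_big1 : 64 * zbound_cst * isqrt R n <= 1.
Hypothesis n_big2 : 128 * schedule_cst * isqrt R n <= balance_rate R k.

Lemma zbound_le1 : zbound <= 1.
Proof.
rewrite -[leRHS](@sqrtr1 R) ler_wsqrtr // ler_pdivrMr // mul1r.
apply: (@le_trans _ _ (zbound_cst * (64 * isqrt R n * n%:R))).
  by rewrite ler_wpM2l // ln_le_size.
by rewrite mulrA mulrCA mulrA ler_piMl ?(ltW n_gt0).
Qed.

Lemma zbound4 : zbound ^+ 4 * n%:R <= zbound_cst ^+ 2 * (32 * isqrt R n).
Proof.
have l := ln_half.
have a0 : 0 <= zbound_cst * ln n.+1%:R / n%:R.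
  by rewrite divr_ge0 ?(ltW n_gt0) // mulr_ge0 //; lra.
rewrite (exprM zbound 2 2) sqr_sqrtr //.
have -> : (zbound_cst * ln n.+1%:R / n%:R) ^+ 2 * n%:R =
   zbound_cst ^+ 2 * (ln n.+1%:R ^+ 2 / n%:R) by field; rewrite gt_eqF.
by rewrite ler_wpM2l ?sqr_ge0 // ler_pdivrMr // ln_le_isqrt // ltnW.
Qed.

Lemma small_mass : n%:R * (n.+1%:R * n.+1%:R ^- 3 + n.+1%:R ^- 3) <=
  2 * isqrt R n.
Proof.
have w0 : 0 < n.+1%:R :> R by rewrite ltr0n.
have e := isqrt2 R n; have h1 := isqrt_le1 R n; have h0 := isqrt_gt0 R n.
have n1 : 2 <= n%:R :> R by rewrite ler_nat.
have -> : n%:R * (n.+1%:R * n.+1%:R ^- 3 + n.+1%:R ^- 3) =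
   n%:R * (n.+1%:R + 1) / n.+1%:R ^+ 3 :> R.
  by field; rewrite gt_eqF.
rewrite ler_pdivrMr ?exprn_gt0 //.
have he : 1 <= isqrt R n * n.+1%:R.
  by rewrite -[leLHS]e expr2 -mulrA ler_piMl // mulr_ge0 // ltW.
apply: (@le_trans _ _ (2 * n.+1%:R ^+ 2)).
  by rewrite -[n.+1%:R]natr1; move: (n%:R : R) n1 => y; nra.
have -> : 2 * isqrt R n * n.+1%:R ^+ 3 =
   (isqrt R n * n.+1%:R) * (2 * n.+1%:R ^+ 2) by ring.
by rewrite ler_peMl // mulr_ge0 // sqr_ge0.
Qed.

Definition tail_cst : R :=
  2 ^+ k * (2 + zbound_cst ^+ 2 * 32) + 8 / balance_rate R k.

Lemma nsol_typical :
  Ex (kclauses k n) m (fun c => ((nsol c)%:R <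
     2 ^+ n * ((1 - bal R k) ^+ m * expR (- (bal R k * n%:R))) *
     (expR (- schedule n m) / 2))%R%:R) <= tail_cst * isqrt R n.
Proof.
have k4 : (4 <= k)%N := leq_trans (isT : (4 <= 12)%N) (large_k eps_lt1).
have kp := large_pow eps_lt1.
have h0 := isqrt_gt0 R k; have hn0 := isqrt_gt0 R n.
have /andP[r0 r1] := rho_bounds eps_lt1.
have l := ln_half.
apply: le_trans (nsol_lower_tail k_le_n k4 kp (schedule n m) m_le) _.
rewrite /tail_cst [leRHS]mulrDl; apply: lerD.
  apply: le_trans (@wcount_lower_tail R k n (ltnW n_ge2) k_le_n k4 kp (isqrt R k)
     (rho R k * norm_bal R k ^+ 2) m (schedule n) zbound h0 _ _ _ _ _ _ _ _ _ _) _.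
  - by have := eps_lt1; lra.
  - exact: isqrt2.
  - by rewrite mulr_ge0 ?sqr_ge0.
  - exact: threshold_rate.
  - by rewrite mulrA [n%:R * _]mulrC ler_wpM2r ?sqr_ge0.
  - by rewrite /schedule expr0 mulr1 mulr_ge0 //; lra.
  - exact: schedule_step.
  - by move=> j /ltnW; apply: zbound_ge.
  - exact: sqrtr_ge0.
  - exact: zbound_le1.
  rewrite expR_schedule0.
  apply: (@le_trans _ _ (2 ^+ k * n%:R * (n.+1%:R * n.+1%:R ^- 3 + zbound ^+ 4
      + n.+1%:R ^- 3))).
    have z0 : 0 <= zbound ^+ 4 by rewrite exprn_ge0 // sqrtr_ge0.
    by rewrite ler_wpM2r // addr_ge0 // addr_ge0 // mulr_ge0.
  rewrite -[leLHS]mulrA -[leRHS]mulrA ler_pM2l ?exprn_gt0 //.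
  have := zbound4; have := small_mass.
  have -> : n%:R * (n.+1%:R * n.+1%:R ^- 3 + zbound ^+ 4 + n.+1%:R ^- 3) =
    n%:R * (n.+1%:R * n.+1%:R ^- 3 + n.+1%:R ^- 3) + zbound ^+ 4 * n%:R by ring.
  move=> a b; apply: le_trans (lerD a b) _.
  by rewrite le_eqVlt; apply/orP; left; apply/eqP; ring.
have t0 := balance_rate_gt0 R k4.
(* The schedule is only logarithmic in n, so half of the exponent of the low balance tail
   survives. *)
have Gs : schedule n m <= 2^-1 * (balance_rate R k * n%:R).
  apply: le_trans (schedule_le (leqnn m)) _.
  apply: le_trans (ler_wpM2l schedule_cst_ge0 ln_le_size) _.
  have := ler_wpM2r (ltW n_gt0) n_big2; lra.
have tn : 0 < balance_rate R k * n%:R by rewrite mulr_gt0.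
apply: (@le_trans _ _ (2 * expR (- (2^-1 * (balance_rate R k * n%:R))))).
  by rewrite ler_pM2l // ler_expR; lra.
apply: (@le_trans _ _ (2 * (2^-1 * (balance_rate R k * n%:R))^-1)).
  rewrite ler_pM2l // expRN lef_pV2 ?posrE ?expR_gt0 //; last first.
    by rewrite mulr_gt0.
  by have := expR_ge1Dx (2^-1 * (balance_rate R k * n%:R)); lra.
have -> : 2 * (2^-1 * (balance_rate R k * n%:R))^-1 =
   4 / balance_rate R k * n%:R^-1 by field; rewrite !gt_eqF.
have -> : 8 / balance_rate R k * isqrt R n =
   4 / balance_rate R k * (2 * isqrt R n) by field; rewrite gt_eqF.
rewrite ler_pM2l ?divr_gt0 //; apply: inv_le_isqrt; exact: ltnW.
Qed.

(** With q = 2^-k, b - q = q b k <= (9/8) k q^2, so a clause costs a factor at most exp(2 k q^2),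
    and m <= 2^k n clauses cost exp(2 k q n). The weight bound exp(b n) adds at most k q n, hence
    the 3. *)
Lemma first_moment_loss :
  (1 - 2 ^- k) ^+ m <=
  (1 - bal R k) ^+ m * expR (3 * k%:R * 2 ^- k * n%:R - bal R k * n%:R).
Proof.
have k12 := large_k eps_lt1.
have kp := large_pow eps_lt1.
have b0 := bal_gt0 kp; have b1 := bal_le kp.
pose q : R := 2 ^- k; rewrite -/q.
have q0 : 0 < q by rewrite invr_gt0 exprn_gt0.
have k0 : 12 <= k%:R :> R by rewrite ler_nat.
have bq : bal R k = q * (1 + bal R k * k%:R).
  by rewrite (bal_balanced kp) mulKf // expf_neq0.
have b2 := balk_le kp.
have bq1 : bal R k <= 9 / 8 * q.
  by rewrite {1}bq mulrC ler_pM2r //; lra.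
have step : 1 - q <= (1 - bal R k) * expR (2 * k%:R * q ^+ 2).
  apply: (@le_trans _ _ ((1 - bal R k) * (1 + 2 * k%:R * q ^+ 2))).
    have e : bal R k - q <= 9 / 8 * (k%:R * q ^+ 2).
      have -> : bal R k - q = q * (bal R k * k%:R).
        by rewrite {1}bq; ring.
      have -> : 9 / 8 * (k%:R * q ^+ 2) =
         q * (9 / 8 * q * k%:R) by ring.
      by rewrite ler_pM2l // ler_wpM2r.
    have : 0 <= k%:R * q ^+ 2 :> R by rewrite mulr_ge0 ?sqr_ge0.
    rewrite -[2 * k%:R * _]mulrA; move: e; move: (k%:R * _) => y e y0.
    by have := ler_wpM2r y0 b1; lra.
  by rewrite ler_wpM2l ?expR_ge1Dx //; lra.
have q1 : q <= 1.
  by rewrite invf_le1 ?exprn_gt0 // exprn_ege1 // ler1n.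
apply: (@le_trans _ _ (((1 - bal R k) * expR (2 * k%:R * q ^+ 2)) ^+ m)).
  by rewrite lerXn2r ?nnegrE ?mulr_ge0 ?expR_ge0 //; lra.
rewrite exprMn ler_wpM2l ?exprn_ge0 //; first by lra.
rewrite -expRM_natl ler_expR.
have e1 : m%:R * (2 * k%:R * q ^+ 2) <= 2 * k%:R * q * n%:R.
  apply: (@le_trans _ _ (2 ^+ k * n%:R * (2 * k%:R * q ^+ 2))).
    by rewrite ler_wpM2r // mulr_ge0 ?sqr_ge0 // mulr_ge0.
  rewrite le_eqVlt; apply/orP; left; apply/eqP; rewrite /q; field.
  by rewrite expf_neq0.
apply: le_trans e1 _.
have : bal R k * n%:R <= k%:R * q * n%:R.
  rewrite ler_pM2r //; apply: le_trans bq1 _; rewrite ler_pM2r //; lra.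
lra.
Qed.

End FixedSize.

End Typical.

(** * Comparison of the planted and uniform models *)

Section FinalBound.
Variable R : realType.

Lemma unif_ge0 (T : finType) (A : {set T}) x : 0 <= unif R A x.
Proof. by rewrite divr_ge0. Qed.

Lemma sum_unif_le1 (T : finType) (A : {set T}) : \sum_x unif R A x <= 1.
Proof.
rewrite /unif -mulr_suml.
have -> : \sum_x (x \in A)%:R = #|A|%:R :> R.
  rewrite -sum1_card natr_sum [RHS]big_mkcond; apply: eq_bigr => x _.
  by case: (x \in A).
have [->|A0] := posnP #|A|; first by rewrite mul0r ler01.
by rewrite mulfV // pnatr_eq0 -lt0n.
Qed.

Lemma Pr_le_sum (T : finType) (mu : T -> R) (A : {set T}) :
  (forall x, 0 <= mu x) -> Pr mu A <= \sum_x mu x.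
Proof.
move=> mu0; rewrite /Pr big_mkcond; apply: ler_sum => x _.
by case: (x \in A).
Qed.

Lemma Pr_uniform_le1 (k n m : nat) (E : {set formula n * assignment n}) :
  Pr (uniform_model k R m) E <= 1.
Proof.
apply: le_trans (Pr_le_sum _ _) _.
  by move=> p; rewrite mulr_ge0 ?unif_ge0.
rewrite -(pair_bigA _ (fun F s => uniform_model k R m (F, s))) /=.
apply: le_trans (sum_unif_le1 (kcnf k n m)); apply: ler_sum => F _.
rewrite /uniform_model /= -mulr_sumr ler_piMr ?unif_ge0 //.
exact: sum_unif_le1.
Qed.

Lemma planted_ge0 (k n m : nat) (p : formula n * assignment n) :
  0 <= planted_model k R m p.
Proof. by rewrite mulr_ge0 ?unif_ge0. Qed.

Lemma Pr_planted_le1 (k n m : nat) (E : {set formula n * assignment n}) :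
  Pr (planted_model k R m) E <= 1.
Proof.
apply: le_trans (Pr_le_sum _ (@planted_ge0 k n m)) _.
rewrite -(pair_bigA _ (fun F s => planted_model k R m (F, s))) /=.
rewrite exchange_big /=.
apply: le_trans (sum_unif_le1 [set: assignment n]%SET); apply: ler_sum => s _.
rewrite /planted_model /= -mulr_sumr ler_piMr ?unif_ge0 //.
exact: sum_unif_le1.
Qed.

Lemma Pr_diff_le (T : finType) (mu : T -> R) (A B : {set T}) (x : R) :
  (forall y, 0 <= mu y) -> Pr mu B <= 1 -> 0 <= x ->
  1 - x <= cPr mu A B -> Pr mu (B :\: A) <= x.
Proof.
move=> mu0 B1 x0; rewrite /cPr.
have E : Pr mu B = Pr mu (A :&: B) + Pr mu (B :\: A).
  rewrite /Pr (bigID (mem A)) /=; congr (_ + _); apply: eq_bigl => y.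
    by rewrite !inE andbC.
  by rewrite !inE andbC.
have P0 : 0 <= Pr mu (A :&: B) by apply: sumr_ge0.
(* For a null B the conditional probability is the default 0, but the difference has no mass
   either. *)
have [B0|B0] := leP (Pr mu B) 0; first by move=> _; lra.
by rewrite ler_pdivlMr // => h; nra.
Qed.

Lemma pow3B (k : nat) : k%:R * 2 ^ (3%:Z - k%:Z) = 8 * k%:R * 2 ^- k :> R.
Proof.
rewrite expfzDr // -exprnN -exprnP.
by move: (2 ^- k) => q; ring.
Qed.

(** There are at least 2^k (n / k)^k clauses, which is of order at least n^3, so a sequence of at
    most 2^k n clauses rarely repeats one. *)
Lemma card_kclauses_lower (k n : nat) : (12 <= k)%N ->
  (2 ^ k.+1 * k ^ k <= n)%N -> (2 * (2 ^ k * n) ^ 2 <= #|kclauses k n|)%N.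
Proof.
move=> k12 nk.
have k0 : (0 < k)%N by apply: leq_trans k12.
have kn : (k <= n)%N.
  apply: leq_trans nk; apply: leq_trans (leq_pmull _ _); last by rewrite expn_gt0.
  by rewrite -[leqLHS]expn1 leq_pexp2l.
rewrite (card_kclauses R).
have -> : (2 * (2 ^ k * n) ^ 2 = 2 ^ k * (2 ^ k.+1 * n ^ 2))%N.
  rewrite expnMn [(2 ^ k.+1)%N]expnS -[((2 ^ k) ^ 2)%N]mulnn [LHS]mulnA [RHS]mulnA.
  by congr (_ * _)%N; rewrite mulnCA.
rewrite leq_pmul2l ?expn_gt0 //.
have kk : (0 < k ^ k)%N by rewrite expn_gt0 k0.
rewrite -(leq_pmul2r kk).
have := bin_ratio k kn; rewrite binn mul1n; apply: leq_trans.
apply: (@leq_trans (n * n ^ 2)).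
  by rewrite mulnAC leq_mul2r nk orbT.
rewrite -expnS leq_pexp2l //; first by apply: leq_trans kn.
by apply: leq_trans k12.
Qed.

Lemma near_isqrt_le (a b : R) : 0 <= a -> 0 < b ->
  \forall n \near \oo, a * isqrt R n <= b.
Proof.
move=> a0 b0; have a1 : 0 < a + 1 by lra.
have : \forall n \near \oo, isqrt R n <= b / (a + 1).
  by apply: isqrt_small; rewrite divr_gt0.
apply: filterS => n; rewrite ler_pdivlMr // => h.
by have := isqrt_gt0 R n; lra.
Qed.

(** Rounding up adds less than 1, which (r' - r) n eventually absorbs. *)
Lemma near_nclauses_le (r r' : R) : 0 <= r -> r < r' ->
  \forall n \near \oo, (nclauses r n)%:R <= r' * n%:R.
Proof.
move=> r0 rr'; have d0 : 0 < r' - r by lra.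
near=> n.
have x0 : 0 <= r * n%:R by rewrite mulr_ge0.
rewrite /nclauses natr_absz ger0_norm; last by rewrite ceil_ge0; lra.
have := ceilB1_lt (r * n%:R); rewrite intrB.
have : (r' - r)^-1 <= n%:R by near: n; apply: nbhs_infty_ger.
rewrite -(ler_pM2l d0) mulfV ?gt_eqF //.
by move: ((Num.ceil _)%:~R) => c; lra.
Unshelve. all: by end_near. Qed.

Lemma cvg_expRN (f : nat -> R) : (f @ \oo --> +oo) ->
  ((fun n => expR (- f n)) @ \oo --> (0 : R)).
Proof.
move=> /cvgryPge foo; apply/cvgrPdist_le => d d0; near=> n.
rewrite sub0r normrN ger0_norm ?expR_ge0 // -[leRHS]lnK ?posrE //.
by rewrite ler_expR lerNl; near: n; apply: foo.
Unshelve. all: by end_near. Qed.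

Section FixedSize.
Variables (k n m : nat).
Hypothesis eps_lt1 : 100 * isqrt R k < 1.
Hypothesis n_ge2 : (2 <= n)%N.
Hypothesis n_pow : (2 ^ k.+1 * k ^ k <= n)%N.
Hypothesis m_rho : m%:R <= rho R k * n%:R.
Hypothesis n_big1 : 64 * zbound_cst R k * isqrt R n <= 1.
Hypothesis n_big2 : 128 * schedule_cst R k * isqrt R n <= balance_rate R k.
Hypothesis n_big3 : 64 * schedule_cst R k * isqrt R n <= 5 * k%:R * 2 ^- k.

(** The ratio of the mean to the typical number of solutions is at most 2 exp(3 k 2^-k n +
    schedule), and for large n the schedule is below 5 k 2^-k n. Together this is the 8 k 2^-k n
    gained in the planted model, leaving 2 exp(- f). *)
Lemma uniform_model_bound (D : {set formula n})
    (E : {set formula n * assignment n}) (fv : R) :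
  1 - expR (- (k%:R * 2 ^ (3%:Z - k%:Z) * n%:R) - fv) <=
    cPr (planted_model k R m) E [set p | p.1 \in D]%SET ->
  Pr (random_kcnf k R m) D - 2 * tail_cst R k * isqrt R n - 2 * expR (- fv) <=
  Pr (uniform_model k R m) E.
Proof.
move=> hE.
have k12 := large_k eps_lt1; have kp := large_pow eps_lt1.
have k0 : (0 < k)%N by apply: leq_trans k12.
have k_le_n : (k <= n)%N.
  apply: leq_trans n_pow; apply: leq_trans (leq_pmull _ _); last by rewrite expn_gt0.
  by rewrite -[leqLHS]expn1 leq_pexp2l.
have n_gt0 : 0 < n%:R :> R by rewrite ltr0n ltnW.
have /andP[r0 r1] := rho_bounds eps_lt1.
have m_le : m%:R <= 2 ^+ k * n%:R :> R.
  by apply: le_trans m_rho _; rewrite ler_wpM2r // ltW.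
have m_leN : (m <= 2 ^ k * n)%N by rewrite -(ler_nat R) natrM natrX.
have K2 := card_kclauses_lower k12 n_pow.
have m2 : (2 * m ^ 2 <= #|kclauses k n|)%N.
  by apply: leq_trans K2; rewrite leq_mul2l /= leq_exp2r.
have K0 : (0 < #|kclauses k n|)%N.
  by rewrite (card_kclauses R) muln_gt0 expn_gt0 bin_gt0.
have mK : (m <= #|kclauses k n|)%N.
  by apply: leq_trans m2; case: (m) => // j; rewrite -mulnn mulnA leq_pmull ?muln_gt0.
have b0 := bal_gt0 kp; have b1 := bal_le kp.
set b := bal R k in b0 b1.
pose z0 : R := 2 ^+ n * ((1 - b) ^+ m * expR (- (b * n%:R))) *
     (expR (- schedule R k n m) / 2).
have z00 : 0 < z0.
  by rewrite !mulr_gt0 ?exprn_gt0 ?expR_gt0 ?invr_gt0 //; lra.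
apply: le_trans (uniform_model_lower k_le_n D E mK z00).
apply: lerB; first apply: lerB => //.
  apply: le_trans (Pr_random_kcnf_le _ K0 mK _) _.
    by rewrite -natrX -natrM ler_nat.
  rewrite -mulrA ler_pM2l //.
  apply: le_trans (nsol_typical eps_lt1 n_ge2 m_le k_le_n m_rho n_big1 n_big2).
  by apply: ler_Ex => c _ _; rewrite inE card_solutions_seq.
have P1 : Pr (planted_model k R m) ([set p | p.1 \in D]%SET :\: E) <=
    expR (- (k%:R * 2 ^ (3%:Z - k%:Z) * n%:R) - fv).
  apply: Pr_diff_le hE; [exact: planted_ge0|exact: Pr_planted_le1|exact: expR_ge0].
have q1 : 0 <= 1 - 2 ^- k :> R.
  by rewrite subr_ge0 invf_le1 ?exprn_gt0 // exprn_ege1 // ler1n.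
have ratio : 2 ^+ n * (1 - 2 ^- k) ^+ m / z0 <=
   2 * expR (3 * k%:R * 2 ^- k * n%:R + schedule R k n m).
  rewrite ler_pdivrMr //.
  have -> : 2 * expR (3 * k%:R * 2 ^- k * n%:R + schedule R k n m) * z0 =
     2 ^+ n * ((1 - b) ^+ m * (expR (3 * k%:R * 2 ^- k * n%:R + schedule R k n m) *
       expR (- (b * n%:R)) * expR (- schedule R k n m))).
    by rewrite /z0; move: (2 ^+ n) ((1 - b) ^+ m) (expR _) => x y z; field.
  rewrite -!expRD ler_pM2l ?exprn_gt0 //.
  apply: le_trans (first_moment_loss eps_lt1 n_ge2 m_le) _.
  have b2 : 0 < 1 - b by lra.
  rewrite -/b ler_pM2l ?exprn_gt0 //.
  by rewrite ler_expR -/b; lra.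
apply: le_trans (ler_pM _ _ ratio P1) _.
- by rewrite divr_ge0 ?(ltW z00) // mulr_ge0 ?exprn_ge0.
- by apply: sumr_ge0 => p _; apply: planted_ge0.
rewrite -[leLHS]mulrA -expRD ler_pM2l // ler_expR pow3B.
have : schedule R k n m <= 5 * k%:R * 2 ^- k * n%:R.
  apply: le_trans (schedule_le n_ge2 m_le (leqnn m)) _.
  have g0 : 0 <= schedule_cst R k by rewrite mulr_ge0 // expR_ge0.
  apply: le_trans (ler_wpM2l g0 (ln_le_size R n_ge2)) _.
  by have := ler_wpM2r (ltW n_gt0) n_big3; move: (2 ^- k) => q; lra.
by move: (2 ^- k) (schedule _ _ _ _) => q y; lra.
Qed.

End FixedSize.

End FinalBound.

Theorem theorem8 (R : realType) :
  exists eps : nat -> R,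
    (eps @ \oo --> (0 : R)) /\
    forall (k : nat) (r : R) (f : nat -> R)
      (D : forall n : nat, {set formula n})
      (E : forall n : nat, {set formula n * assignment n}),
    0 <= r ->
    r < (1 - eps k) * 2 ^+ k * ln 2 ->
    (f @ \oo --> +oo) ->
    ((fun n : nat => Pr (random_kcnf k R (nclauses r n)) (D n)) @ \oo
       --> (1 : R)) ->
    (forall n : nat, E n \subset Lambda k n (nclauses r n)) ->
    (\forall n \near \oo,
       1 - expR (- (k%:R * 2 ^ (3%:Z - k%:Z) * n%:R) - f n)
       <= cPr (planted_model k R (nclauses r n)) (E n)
              [set p | p.1 \in D n]%SET) ->
    ((fun n : nat => Pr (uniform_model k R (nclauses r n)) (E n)) @ \oo
       --> (1 : R)).
Proof.
exists (fun k => 100 * isqrt R k); split.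
  by rewrite -(mulr0 100); apply: cvgMr; apply: isqrt_cvg.
move=> k r f D E r0 rlt f_oo D1 _ hE.
have Gk0 : 0 <= schedule_cst R k by rewrite mulr_ge0 // expR_ge0.
have Ak0 : 0 <= zbound_cst R k by rewrite mulr_ge0 // addr_ge0 // !mulr_ge0.
(* A nonnegative r below the threshold forces 1 - eps_k > 0, so k is large. *)
have eps1 : 100 * isqrt R k < 1.
  rewrite -subr_gt0; have := le_lt_trans r0 rlt.
  rewrite pmulr_lgt0; last by have /andP[] := ln2_bounds R; lra.
  by rewrite pmulr_lgt0 // exprn_gt0.
have k12 := large_k eps1.
have k4 : (4 <= k)%N by apply: leq_trans k12.
have kR0 : 0 < k%:R :> R by rewrite ltr0n (leq_trans _ k12).
(* Small k being excluded, the probability is squeezed between the bound of [uniform_model_bound]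
   and 1. *)
apply: (@squeeze_cvgr _ _ _ _ (fun n =>
   Pr (random_kcnf k R (nclauses r n)) (D n) - 2 * tail_cst R k * isqrt R n
   - 2 * expR (- f n)) (fun=> 1)); last exact: cvg_cst.
- near=> n; apply/andP; split; last exact: Pr_uniform_le1.
  apply: uniform_model_bound => //.
  + by near: n; apply: nbhs_infty_ge.
  + by near: n; apply: nbhs_infty_ge.
  + by near: n; apply: near_nclauses_le.
  + by near: n; apply: near_isqrt_le; rewrite // mulr_ge0.
  + by near: n; apply: near_isqrt_le; rewrite ?balance_rate_gt0 ?mulr_ge0.
  + by near: n; apply: near_isqrt_le; rewrite ?mulr_ge0 // !mulr_gt0.
  + by near: n.
- rewrite -[X in _ --> X]subr0 -[X in _ --> X - _]subr0; apply: cvgB.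
    apply: cvgB => //.
    by rewrite -(mulr0 (2 * tail_cst R k)); apply: cvgMr; apply: isqrt_cvg.
  by rewrite -(mulr0 2); apply: cvgMr; apply: cvg_expRN.
Unshelve. all: by end_near.
Qed.
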